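(* Let $r\in C([0,\infty);(0,\infty))$ satisfy $r\in\mathrm{RV}_\infty(\mu)$ for some $\mu\in(-1,-1/2)$. Then $c(t):=\int_0^\infty r(s)r(s+t)\,ds$ is finite for every $t\ge0$ and $$\lim_{t\to\infty}\frac{c(t)}{t\,r^2(t)}=\frac{\Gamma(-1-2\mu)\Gamma(1+\mu)}{\Gamma(-\mu)}>0.$$
   Context: $f\in\mathrm{RV}_\infty(\mu)$ means $f(t)=t^\mu L(t)$ with $L$ positive and slowly varying at infinity, i.e. $L(xt)/L(t)\to1$ as $t\to\infty$ for every $x>0$. *)

(* Defs.v *)
From Stdlib Require Import Reals Lra ClassicalEpsilon.
Open Scope R_scope.

Definition slowly_varying (L : R -> R) : Prop :=
  forall x, 0 < x -> forall eps, 0 < eps ->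
    exists T, 0 < T /\ forall t, T < t -> Rabs (L (x * t) / L t - 1) < eps.

Definition RV_inf (mu : R) (f : R -> R) : Prop :=
  exists L : R -> R,
    (forall t, 0 < t -> 0 < L t) /\ slowly_varying L /\
    (forall t, 0 < t -> f t = Rpower t mu * L t).

Definition continuous_on_nonneg (f : R -> R) : Prop :=
  forall t, 0 <= t -> limit1_in f (fun x => 0 <= x) (f t) t.

Definition improper_int_0_inf (f : R -> R) (l : R) : Prop :=
  (forall b, 0 <= b -> inhabited (Riemann_integrable f 0 b)) /\
  forall eps, 0 < eps -> exists B, 0 < B /\
    forall b (pr : Riemann_integrable f 0 b), B < b -> Rabs (RiemannInt pr - l) < eps.

Definition improper_int_open (f : R -> R) (l : R) : Prop :=
  (forall a b, 0 < a -> a <= b -> inhabited (Riemann_integrable f a b)) /\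
  forall eps, 0 < eps -> exists d B, 0 < d /\ d < B /\
    forall a b (pr : Riemann_integrable f a b), 0 < a -> a < d -> B < b ->
      Rabs (RiemannInt pr - l) < eps.

Definition Gamma (x : R) : R :=
  epsilon (inhabits 0)
    (fun g => improper_int_open (fun s => Rpower s (x - 1) * exp (- s)) g).

Definition lim_inf_to (f : R -> R) (l : R) : Prop :=
  forall eps, 0 < eps -> exists T, 0 < T /\ forall t, T < t -> Rabs (f t - l) < eps.

(* Main.v *)
(** Rescaling [s] by [t] turns [c t / (t * r t ^ 2)] into the integral over
    [s > 0] of [r (t s) / r t * (r (t (1 + s)) / r t)], whose integrand tends to
    [s^mu (1 + s)^mu].  The uniform convergence theorem for slowly varying functions
    handles [eta <= s <= K], and Potter bounds make the contributions of [s < eta]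
    and [s > K] small, so the limit is the beta integral B(1 + mu, -1 - 2 mu).
    For the latter, [s^(a-1) y^(a+b-1) exp (- y (1 + s))] is integrated over
    rectangles in both orders. *)

Require Import Defs.
From Stdlib Require Import Reals Lra ClassicalEpsilon Classical.
From Coquelicot Require Import Coquelicot.
Open Scope R_scope.

(** * Uniform convergence and Potter bounds *)

(** Slow variation only gives convergence for each fixed ratio. Continuity of [r] upgrades it to
    uniformity through a category argument on the logarithmic scale, and Potter bounds follow by
    chaining unit steps. These bounds hold only beyond some [X], so the unscaled range [s < X] is
    treated apart: it contributes O(r t), negligible against [t * r t ^ 2] because mu > -1 forces
    [t * r t] to infinity. For small d > 0, mu > -1 also makes s^(mu - d) integrable at zero, and mu
    < -1/2 makes s^(2 (mu + d)) integrable at infinity. [Gamma] is a value picked by [epsilon], so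
    convergence of its integral must be proved before anything can be said about it. The integrands
    are nonnegative, hence their improper integrals are suprema of proper ones, and the beta
    identity reduces to two inequalities over suitably chosen rectangles. *)

Lemma Rmax_le_elim (x y z : R) : Rmax x y <= z -> x <= z /\ y <= z.
Proof. intros H; pose proof (Rmax_l x y); pose proof (Rmax_r x y); lra. Qed.

Lemma exp_le_compat (x y : R) : x <= y -> exp x <= exp y.
Proof. intros [H| ->]; [left; apply exp_increasing, H | right; reflexivity]. Qed.

Lemma continuous_locally_gt (f : R -> R) (x m : R) :
  continuity_pt f x -> m < f x ->
  exists d, 0 < d /\ forall y, Rabs (y - x) < d -> m < f y.
Proof.
  intros Hf Hm.
  destruct (Hf (f x - m) ltac:(lra)) as [d [Hd H]].
  exists d; split; [exact Hd|]; intros y Hy.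
  destruct (Req_dec x y) as [<-|Hne]; [exact Hm|].
  assert (Hfy : Rabs (f y - f x) < f x - m).
  { apply H; split; [split; [exact I | exact Hne] | exact Hy]. }
  apply Rabs_def2 in Hfy; lra.
Qed.

Lemma nested_intervals (p : nat -> R * R) :
  (forall n, fst (p n) <= fst (p (S n)) /\ fst (p n) < snd (p n) /\
             snd (p (S n)) <= snd (p n)) ->
  exists l, forall n, fst (p n) <= l <= snd (p n).
Proof.
  intros Hp.
  assert (Hmono : forall n k, fst (p n) <= fst (p (n + k)%nat) /\
                              snd (p (n + k)%nat) <= snd (p n)).
  { intros n k; induction k as [|k IH].
    - rewrite Nat.add_0_r; lra.
    - rewrite Nat.add_succ_r; specialize (Hp (n + k)%nat); lra. }
  assert (Hcross : forall n m, fst (p n) <= snd (p m)).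
  { intros n m.
    pose proof (Hmono n m) as H1; pose proof (Hmono m n) as H2.
    rewrite (Nat.add_comm m n) in H2; specialize (Hp (n + m)%nat); lra. }
  destruct (completeness (fun x => exists n, x = fst (p n))) as [l [Hub Hlub]].
  - exists (snd (p 0%nat)); intros x [n ->]; apply Hcross.
  - exists (fst (p 0%nat)), 0%nat; reflexivity.
  - exists l; intros n; split.
    + apply Hub; exists n; reflexivity.
    + apply Hlub; intros x [m ->]; apply Hcross.
Qed.

(** Slow variation in additive form, for h v = ln (L (exp v)). The threshold [N] depends on [u];
    removing this dependence on compact sets is the uniform convergence theorem. *)
Definition increments_vanish (h : R -> R) : Prop :=
  forall u eps, 0 < eps ->
    exists N, forall v, N < v -> Rabs (h (v + u) - h v) < eps.

(* Baire category: the closed sets [{u | |h (v+u) - h v| <= eps for all v >= n}]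
   cover the line, so one of them contains an interval. *)
Lemma increments_small_on_interval (h : R -> R) (eps : R) :
  continuity h -> increments_vanish h -> 0 < eps ->
  exists N a b, a < b /\
    forall v u, N <= v -> a <= u <= b -> Rabs (h (v + u) - h v) <= eps.
Proof.
  intros Hc Hh Heps; apply NNPP; intros Hno.
  (* [q] is a subinterval of [p] on all of which a single [v >= n] violates the bound. *)
  pose (good n (p q : R * R) := fst p <= fst q /\ fst q < snd q /\ snd q <= snd p /\
     exists v, INR n <= v /\
       forall u, fst q <= u <= snd q -> eps < Rabs (h (v + u) - h v)).
  assert (Hstep : forall n p, fst p < snd p -> exists q, good n p q).
  { intros n [a b] Hab; simpl in Hab.
    destruct (classic (exists v u, INR n <= v /\ a <= u <= b /\
                         eps < Rabs (h (v + u) - h v))) as [(v & u & Hv & Hu & Hgt)|Hnone].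
    (* A violation at one [u] persists near [u] for the same [v], by continuity of [h]. *)
    - destruct (continuous_locally_gt (fun u => Rabs (h (v + u) - h v)) u eps)
        as [d [Hd Hnear]]; [|exact Hgt|].
      { apply (continuity_pt_comp (fun u => h (v + u) - h v) Rabs);
          [|apply Rcontinuity_abs].
        apply continuity_pt_minus; [|apply continuity_pt_const; intros ? ?; reflexivity].
        apply (continuity_pt_comp (fun u => v + u) h); [|apply Hc].
        apply continuity_pt_plus; [apply continuity_pt_const; intros ? ?; reflexivity|].
        apply derivable_continuous_pt, derivable_pt_id. }
      exists (Rmax a (u - d / 2), Rmin b (u + d / 2)); unfold good; simpl.
      pose proof (Rmax_l a (u - d / 2)); pose proof (Rmax_r a (u - d / 2)).
      pose proof (Rmin_l b (u + d / 2)); pose proof (Rmin_r b (u + d / 2)).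
      repeat split; try assumption.
      + apply Rmax_lub_lt; apply Rmin_glb_lt; lra.
      + exists v; split; [exact Hv|]; intros w Hw; apply Hnear, Rabs_def1; lra.
    - exfalso; apply Hno; exists (INR n), a, b; split; [exact Hab|].
      intros v u Hv Hu; apply Rnot_lt_le; intros Hlt.
      apply Hnone; exists v, u; auto. }
  pose (p := fix p n := match n with O => (0, 1)
                        | S n => epsilon (inhabits (0, 0)) (good n (p n)) end).
  assert (Hp : forall n, fst (p n) < snd (p n) /\ good n (p n) (p (S n))).
  { intros n; induction n as [|n [IH1 IH2]].
    - split; [simpl; lra|].
      apply (epsilon_spec (inhabits (0, 0)) (good O (p O))), Hstep; simpl; lra.
    - assert (H1 : fst (p (S n)) < snd (p (S n))) by apply IH2.
      split; [exact H1|].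
      apply (epsilon_spec (inhabits (0, 0)) (good (S n) (p (S n)))), Hstep, H1. }
  destruct (nested_intervals p) as [l Hl].
  { intros n; destruct (Hp n) as [H1 (H2 & _ & H3 & _)]; auto. }
  (* The common point [l] of the intervals is violated by arbitrarily large [v], against the
     vanishing of the increment at [u = l]. *)
  destruct (Hh l eps Heps) as [N HN].
  destruct (INR_unbounded N) as [n Hn].
  destruct (Hp n) as [_ (_ & _ & _ & v & Hv & Hbig)].
  specialize (Hbig l (Hl (S n))); specialize (HN v ltac:(lra)); lra.
Qed.

(** Differences of two increments move the good interval [[a, b]] to [[0, b - a]]. It is then
    extended by [b - a] at a time. Errors do not accumulate: each extension restarts from the
    pointwise hypothesis at the single point [w], with tolerance [eps / 2]. *)
Lemma increments_vanish_uniformly (h : R -> R) (K eps : R) :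
  continuity h -> increments_vanish h -> 0 < eps ->
  exists N, forall v u, N <= v -> 0 <= u <= K -> Rabs (h (v + u) - h v) <= eps.
Proof.
  intros Hc Hh Heps.
  destruct (increments_small_on_interval h (eps / 4) Hc Hh ltac:(lra))
    as (N0 & a & b & Hab & H0).
  assert (Hlocal : forall v u, N0 + a <= v -> 0 <= u <= b - a ->
                     Rabs (h (v + u) - h v) <= eps / 2).
  { intros v u Hv Hu.
    pose proof (H0 (v - a) (a + u) ltac:(lra) ltac:(lra)) as H1.
    pose proof (H0 (v - a) a ltac:(lra) ltac:(lra)) as H2.
    replace (v - a + (a + u)) with (v + u) in H1 by ring.
    replace (v - a + a) with v in H2 by ring.
    apply Rabs_le_between in H1; apply Rabs_le_between in H2; apply Rabs_le_between; lra. }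
  assert (Hk : forall k, exists N, forall v u, N <= v -> 0 <= u <= INR k * (b - a) ->
                     Rabs (h (v + u) - h v) <= eps).
  { intros k; induction k as [|k [N HN]].
    - exists 0; intros v u _ Hu; simpl in Hu.
      replace (v + u) with v by lra.
      rewrite Rminus_diag, Rabs_R0; lra.
    - set (w := INR k * (b - a)) in *.
      assert (Hw : 0 <= w) by (apply Rmult_le_pos; [apply pos_INR | lra]).
      destruct (Hh w (eps / 2) ltac:(lra)) as [M HM].
      exists (Rmax N (Rmax (M + 1) (N0 + a))); intros v u Hv Hu.
      rewrite S_INR in Hu.
      apply Rmax_le_elim in Hv; destruct Hv as [HvN Hv].
      apply Rmax_le_elim in Hv; destruct Hv as [HvM Hva].
      destruct (Rle_dec u w) as [Huw|Huw]; [apply HN; lra|].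
      pose proof (Hlocal (v + w) (u - w) ltac:(lra) ltac:(unfold w in *; lra)) as H1.
      pose proof (HM v ltac:(lra)) as H2.
      replace (v + w + (u - w)) with (v + u) in H1 by ring.
      apply Rabs_le_between in H1; apply Rabs_def2 in H2; apply Rabs_le_between; lra. }
  destruct (INR_unbounded (K / (b - a))) as [k Hk'].
  destruct (Hk k) as [N HN]; exists N; intros v u Hv Hu; apply HN; [exact Hv|].
  split; [lra|]; apply Rle_trans with K; [lra|].
  apply Rmult_lt_compat_r with (r := b - a) in Hk'; [|lra].
  unfold Rdiv in Hk'; rewrite Rmult_assoc, Rinv_l in Hk' by lra; lra.
Qed.

(** Uniformity on [[0, 1]] costs [d] per unit step, and at most [1 + u] steps are made. *)
Lemma increments_sublinear (h : R -> R) (d : R) :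
  continuity h -> increments_vanish h -> 0 < d ->
  exists N, forall v u, N <= v -> 0 <= u -> Rabs (h (v + u) - h v) <= d * (1 + u).
Proof.
  intros Hc Hh Hd.
  destruct (increments_vanish_uniformly h 1 d Hc Hh Hd) as [N HN].
  exists N.
  assert (Hn : forall n v u, N <= v -> 0 <= u <= INR n ->
                 Rabs (h (v + u) - h v) <= d * (1 + u)).
  { intros n; induction n as [|n IH]; intros v u Hv Hu.
    - simpl in Hu; apply Rle_trans with d; [apply HN; lra | nra].
    - rewrite S_INR in Hu; destruct (Rle_dec u 1) as [Hu1|Hu1].
      + apply Rle_trans with d; [apply HN; lra | nra].
      + pose proof (IH v (u - 1) Hv ltac:(lra)) as H1.
        pose proof (HN (v + (u - 1)) 1 ltac:(lra) ltac:(lra)) as H2.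
        replace (v + (u - 1) + 1) with (v + u) in H2 by ring.
        apply Rabs_le_between in H1; apply Rabs_le_between in H2.
        apply Rabs_le_between; nra. }
  intros v u Hv Hu; destruct (INR_unbounded u) as [n Hun].
  apply (Hn n); [exact Hv | lra].
Qed.

(** This is ln (L (exp v)) when r t = t^mu L(t). Written through [r], it inherits continuity
    directly. *)
Definition log_slow_part (mu : R) (r : R -> R) (v : R) : R := ln (r (exp v)) - mu * v.

Lemma continuity_log_slow_part (r : R -> R) (mu : R) :
  (forall x, continuous r x) -> (forall x, 0 < x -> 0 < r x) ->
  continuity (log_slow_part mu r).
Proof.
  intros Hc Hpos v; apply continuity_pt_filterlim.
  apply (continuous_minus (fun v => ln (r (exp v))) (fun v => mu * v)).
  - apply (continuous_comp (fun v => r (exp v)) ln).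
    + apply (continuous_comp exp r); [apply continuous_exp | apply Hc].
    + apply continuous_ln, Hpos, exp_pos.
  - apply (continuous_mult (fun _ => mu) (fun v => v));
      [apply continuous_const | apply continuous_id].
Qed.

Lemma log_slow_part_RV (r : R -> R) (mu : R) :
  RV_inf mu r -> increments_vanish (log_slow_part mu r).
Proof.
  intros (L & HL & Hs & Hr) u eps Heps.
  (* This tolerance is the distance from 1 to exp (- eps). It is at most exp eps - 1, so it serves
     both sides of the logarithm. *)
  destruct (Hs (exp u) (exp_pos u) (1 - exp (- eps))) as (T & HT & H).
  { pose proof (exp_increasing (- eps) 0 ltac:(lra)); rewrite exp_0 in *; lra. }
  exists (ln T); intros v Hv.
  assert (HTv : T < exp v) by (rewrite <- (exp_ln T HT); apply exp_increasing, Hv).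
  assert (Hpart : forall w, log_slow_part mu r w = ln (L (exp w))).
  { intros w; unfold log_slow_part.
    rewrite (Hr _ (exp_pos w)), ln_mult by (try apply HL; apply exp_pos).
    unfold Rpower; rewrite !ln_exp; ring. }
  rewrite !Hpart, Rplus_comm, exp_plus.
  specialize (H _ HTv).
  assert (H1 : 0 < L (exp v)) by apply HL, exp_pos.
  assert (H2 : 0 < L (exp u * exp v)) by (apply HL, Rmult_lt_0_compat; apply exp_pos).
  unfold Rminus; rewrite <- ln_Rinv, <- ln_mult by (auto; apply Rinv_0_lt_compat, H1).
  change (L (exp u * exp v) * / L (exp v)) with (L (exp u * exp v) / L (exp v)).
  assert (Hq : 0 < L (exp u * exp v) / L (exp v)) by (apply Rdiv_lt_0_compat; auto).
  apply Rabs_def2 in H.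
  assert (Hamgm : 1 - exp (- eps) <= exp eps - 1).
  { pose proof (exp_ineq1_le eps); pose proof (exp_ineq1_le (- eps)); lra. }
  apply Rabs_def1.
  - rewrite <- (ln_exp eps); apply ln_increasing; lra.
  - rewrite <- (ln_exp (- eps)); apply ln_increasing; [apply exp_pos | lra].
Qed.

Lemma RV_eq_exp (r : R -> R) (mu s t : R) :
  0 < s -> 0 < t -> 0 < r s -> 0 < r t ->
  r s = r t * Rpower (s / t) mu *
        exp (log_slow_part mu r (ln s) - log_slow_part mu r (ln t)).
Proof.
  intros Hs Ht Hrs Hrt; unfold log_slow_part, Rpower.
  rewrite !exp_ln by assumption.
  rewrite <- (exp_ln (r s) Hrs) at 1; rewrite <- (exp_ln (r t) Hrt) at 1.
  rewrite <- !exp_plus, ln_div by assumption; f_equal; ring.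
Qed.

(** The two conditions on [K] confine [s / t] to a compact subset of the positive axis. They are
    symmetric in [s] and [t], so the logarithmic estimate is needed only for [s <= t]. *)
Lemma RV_uniform (r : R -> R) (mu K eps : R) :
  (forall x, continuous r x) -> (forall x, 0 < x -> 0 < r x) -> RV_inf mu r ->
  0 < eps ->
  exists T, 0 < T /\ forall s t, T <= s -> T <= t -> s <= K * t -> t <= K * s ->
    exp (- eps) * (r t * Rpower (s / t) mu) <= r s <=
    exp eps * (r t * Rpower (s / t) mu).
Proof.
  intros Hc Hpos HRV Heps; set (h := log_slow_part mu r).
  destruct (increments_vanish_uniformly h (ln K) eps) as [N HN];
    [apply continuity_log_slow_part | apply log_slow_part_RV | |]; auto.
  exists (exp N); split; [apply exp_pos|].
  assert (Hle : forall s t, exp N <= s -> s <= t -> t <= K * s ->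
                  Rabs (h (ln t) - h (ln s)) <= eps).
  { intros s t Hs Hst HtK.
    assert (Hs0 : 0 < s) by (pose proof (exp_pos N); lra).
    replace (ln t) with (ln s + (ln t - ln s)) by ring; apply HN.
    - rewrite <- (ln_exp N); apply ln_le; [apply exp_pos | exact Hs].
    - split; [pose proof (ln_le s t Hs0 Hst); lra|].
      assert (HK : 0 < K) by nra.
      apply ln_le in HtK; [|lra]; rewrite ln_mult in HtK by lra; lra. }
  intros s t Hs Ht HsK HtK.
  assert (Habs : Rabs (h (ln s) - h (ln t)) <= eps).
  { destruct (Rle_dec s t); [rewrite Rabs_minus_sym|]; apply Hle; lra. }
  apply Rabs_le_between in Habs.
  assert (Hs0 : 0 < s) by (pose proof (exp_pos N); lra).
  assert (Ht0 : 0 < t) by (pose proof (exp_pos N); lra).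
  assert (H0 : 0 < r t * Rpower (s / t) mu).
  { apply Rmult_lt_0_compat; [apply Hpos, Ht0 | apply exp_pos]. }
  rewrite (RV_eq_exp r mu s t Hs0 Ht0) by auto; fold h.
  rewrite (Rmult_comm _ (exp (h _ - _))).
  split; (apply Rmult_le_compat_r; [lra | apply exp_le_compat; lra]).
Qed.

(** One [d] serves as both constant and exponent: exponentiating the bound [d * (1 + u)] with u = ln
    (t / s) gives the factor exp d and the power (t / s)^d. *)
Definition potter_bounds (r : R -> R) (mu d X : R) : Prop :=
  forall s t, X <= s -> s <= t ->
    r t <= exp d * (r s * Rpower (t / s) (mu + d)) /\
    r s <= exp d * (r t * Rpower (s / t) (mu - d)).

Lemma RV_potter (r : R -> R) (mu d : R) :
  (forall x, continuous r x) -> (forall x, 0 < x -> 0 < r x) -> RV_inf mu r ->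
  0 < d ->
  exists X, 0 < X /\ potter_bounds r mu d X.
Proof.
  intros Hc Hpos HRV Hd; set (h := log_slow_part mu r).
  destruct (increments_sublinear h d) as [N HN];
    [apply continuity_log_slow_part | apply log_slow_part_RV | |]; auto.
  exists (exp N); split; [apply exp_pos|]; intros s t Hs Hst.
  assert (Hs0 : 0 < s) by (pose proof (exp_pos N); lra).
  assert (Ht0 : 0 < t) by lra.
  assert (Habs : Rabs (h (ln t) - h (ln s)) <= d * (1 + (ln t - ln s))).
  { replace (ln t) with (ln s + (ln t - ln s)) at 1 by ring; apply HN.
    - rewrite <- (ln_exp N); apply ln_le; [apply exp_pos | exact Hs].
    - pose proof (ln_le s t Hs0 Hst); lra. }
  apply Rabs_le_between in Habs.
  (* Collects the slack into one exponential, to be compared with the increment of [h]. In the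
     second bound e = - d and ln (s / t) <= 0, so the exponent is again d (1 + ln (t / s)). *)
  assert (Hrw : forall x y e, exp d * (r x * Rpower (y / x) (mu + e)) =
                 r x * Rpower (y / x) mu * exp (d + e * ln (y / x))).
  { intros x y e; rewrite Rpower_plus, exp_plus; unfold Rpower; ring. }
  split; [|replace (mu - d) with (mu + - d) by ring]; rewrite Hrw.
  - rewrite (RV_eq_exp r mu t s) at 1 by auto; fold h.
    apply Rmult_le_compat_l.
    + apply Rlt_le, Rmult_lt_0_compat; [apply Hpos, Hs0 | apply exp_pos].
    + apply exp_le_compat; rewrite ln_div by auto; lra.
  - rewrite (RV_eq_exp r mu s t) at 1 by auto; fold h.
    apply Rmult_le_compat_l.
    + apply Rlt_le, Rmult_lt_0_compat; [apply Hpos, Ht0 | apply exp_pos].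
    + apply exp_le_compat; rewrite ln_div by auto; lra.
Qed.

(** * Fubini on rectangles *)

Lemma continuity_2d_pt_section_r (f : R -> R -> R) (x y : R) :
  continuity_2d_pt f x y -> continuous (f x) y.
Proof.
  intros H; apply continuity_pt_filterlim; intros eps Heps.
  destruct (H (mkposreal eps Heps)) as [d Hd].
  exists d; split; [apply cond_pos|]; intros z [_ Hz].
  apply (Hd x z); [rewrite Rminus_diag, Rabs_R0; apply cond_pos | exact Hz].
Qed.

Lemma continuity_2d_pt_swap (f : R -> R -> R) (x y : R) :
  continuity_2d_pt f x y -> continuity_2d_pt (fun u v => f v u) y x.
Proof.
  intros H eps; destruct (H eps) as [d Hd].
  exists d; intros u v Hu Hv; apply Hd; assumption.
Qed.

Lemma ex_RInt_pos (f : R -> R) (a b : R) :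
  (forall x, 0 < x -> continuous f x) -> 0 < a -> 0 < b -> ex_RInt f a b.
Proof.
  intros Hf Ha Hb; apply (ex_RInt_continuous (V := R_CompleteNormedModule)).
  intros z [Hz _]; apply Hf; pose proof (Rmin_glb_lt a b 0 Ha Hb); lra.
Qed.

Lemma continuous_RInt_section_le (f : R -> R -> R) (x c d : R) :
  (forall x y, 0 < x -> 0 < y -> continuity_2d_pt f x y) ->
  0 < x -> 0 < c -> c <= d ->
  continuous (fun x => RInt (fun y => f x y) c d) x.
Proof.
  intros Hf Hx Hc Hcd.
  assert (Hex : forall w, 0 < w -> ex_RInt (fun y => f w y) c d).
  { intros w Hw; apply ex_RInt_pos; try lra.
    intros y Hy; apply continuity_2d_pt_section_r, Hf; assumption. }
  apply continuity_pt_filterlim; intros eps Heps.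
  (* The [+ 1] covers [c = d] and makes the final estimate strict. *)
  assert (He : 0 < eps / (d - c + 1)) by (apply Rdiv_lt_0_compat; lra).
  destruct (uniform_continuity_2d_1d' f c d x) with (eps := mkposreal _ He)
    as [delta Hdelta].
  { intros y Hy; apply Hf; lra. }
  simpl in Hdelta.
  exists (Rmin delta x); split.
  (* Taking the minimum with [x] keeps the nearby points positive, where [f] is known to be
     continuous. *)
  { apply Rmin_glb_lt; [apply cond_pos | exact Hx]. }
  intros z [_ Hz]; simpl in Hz; unfold R_dist in Hz.
  pose proof (Rmin_l delta x); pose proof (Rmin_r delta x).
  apply Rabs_def2 in Hz.
  simpl; unfold R_dist.
  change (RInt (fun y => f z y) c d - RInt (fun y => f x y) c d)
    with (minus (RInt (fun y => f z y) c d) (RInt (fun y => f x y) c d)).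
  rewrite <- RInt_minus by (apply Hex; lra).
  apply Rle_lt_trans with ((d - c) * (eps / (d - c + 1))).
  - apply abs_RInt_le_const; [exact Hcd | |].
    + apply (ex_RInt_minus (fun y => f z y) (fun y => f x y)); apply Hex; lra.
    + intros t Ht; apply Rlt_le, (Hdelta t x t z); try lra.
      rewrite Rminus_diag, Rabs_R0; apply cond_pos.
  - apply Rmult_lt_reg_r with (d - c + 1); [lra|].
    replace ((d - c) * (eps / (d - c + 1)) * (d - c + 1)) with ((d - c) * eps)
      by (field; lra).
    nra.
Qed.

(** Either order of the bounds is allowed because Fubini differentiates in an upper limit that may
    fall below [a]. *)
Lemma continuous_RInt_section (f : R -> R -> R) (x c d : R) :
  (forall x y, 0 < x -> 0 < y -> continuity_2d_pt f x y) ->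
  0 < x -> 0 < c -> 0 < d ->
  continuous (fun x => RInt (fun y => f x y) c d) x.
Proof.
  intros Hf Hx Hc Hd.
  assert (Hex : forall w c d, 0 < w -> 0 < c -> 0 < d -> ex_RInt (fun y => f w y) c d).
  { intros w c' d' Hw Hc' Hd'; apply ex_RInt_pos; try assumption.
    intros y Hy; apply continuity_2d_pt_section_r, Hf; assumption. }
  destruct (Rle_or_lt c d) as [Hcd|Hdc].
  { apply continuous_RInt_section_le; assumption. }
  apply (continuous_ext_loc _ (fun x => opp (RInt (fun y => f x y) d c))).
  - apply (filter_imp (fun w => 0 < w)); [|apply (open_gt 0 x Hx)].
    intros w Hw; apply (opp_RInt_swap (fun y => f w y)), Hex; assumption.
  - apply (continuous_opp (fun x => RInt (fun y => f x y) d c));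
    apply continuous_RInt_section_le; try assumption; lra.
Qed.

(* Both sides, as functions of the upper bound [b], have derivative
   [RInt (f b) c d] and vanish at [b = a]. *)
Lemma Fubini_rectangle (f : R -> R -> R) (a b c d : R) :
  (forall x y, 0 < x -> 0 < y -> continuity_2d_pt f x y) ->
  0 < a -> a <= b -> 0 < c -> c <= d ->
  RInt (fun x => RInt (fun y => f x y) c d) a b =
  RInt (fun y => RInt (fun x => f x y) a b) c d.
Proof.
  intros Hf Ha Hab Hc Hcd.
  assert (Hcx : forall x y, 0 < x -> 0 < y -> continuous (fun x => f x y) x).
  { intros x y Hx Hy.
    apply (continuity_2d_pt_section_r (fun y x => f x y)).
    apply continuity_2d_pt_swap, Hf; assumption. }
  assert (Hpos : forall x, 0 < x -> locally x (fun z => 0 < z)).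
  { intros x Hx; apply (open_gt 0 x Hx). }
  assert (Hder : forall x y, 0 < x -> 0 < y ->
            is_derive (fun T => RInt (fun x => f x y) a T) x (f x y)).
  { intros x y Hx Hy; apply (is_derive_RInt (fun x => f x y) _ a).
    - apply (filter_imp (fun z => 0 < z)); [|apply Hpos, Hx].
      intros z Hz; apply (RInt_correct (V := R_CompleteNormedModule)).
      apply ex_RInt_pos; auto.
    - apply Hcx; assumption. }
  pose (G := fun T => RInt (fun x => RInt (fun y => f x y) c d) a T).
  pose (H := fun T => RInt (fun y => RInt (fun x => f x y) a T) c d).
  assert (HG : forall T, 0 < T -> is_derive G T (RInt (fun y => f T y) c d)).
  { intros T HT.
    apply (is_derive_RInt (fun x => RInt (fun y => f x y) c d) G a).
    - apply (filter_imp (fun z => 0 < z)); [|apply Hpos, HT].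
      intros z Hz; apply (RInt_correct (V := R_CompleteNormedModule)).
      apply ex_RInt_pos; auto.
      intros x Hx; apply continuous_RInt_section; lra || assumption.
    - apply continuous_RInt_section; lra || assumption. }
  assert (HH : forall T, 0 < T -> is_derive H T (RInt (fun y => f T y) c d)).
  { intros T HT.
    (* Differentiation under the integral sign expects a [Derive]; by the fundamental theorem of
       calculus it equals [f T y]. *)
    rewrite (RInt_ext (fun y => f T y)
               (fun y => Derive (fun T => RInt (fun x => f x y) a T) T)).
    2:{ intros y [Hy _]; rewrite Rmin_left in Hy by lra.
        symmetry; apply is_derive_unique, Hder; lra. }
    apply (is_derive_RInt_param (fun T y => RInt (fun x => f x y) a T) c d T).
    - apply (filter_imp (fun z => 0 < z)); [|apply Hpos, HT].
      intros z Hz y [Hy _]; rewrite Rmin_left in Hy by lra.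
      exists (f z y); apply Hder; lra.
    - intros y [Hy _]; rewrite Rmin_left in Hy by lra.
      apply (continuity_2d_pt_ext_loc f); [|apply Hf; lra].
      destruct (Hpos T HT) as [d1 H1]; destruct (Hpos y ltac:(lra)) as [d2 H2].
      exists (mkposreal _ (Rmin_stable_in_posreal d1 d2)); simpl; intros u v Hu Hv.
      symmetry; apply is_derive_unique, Hder.
      + apply H1, (Rlt_le_trans _ _ _ Hu), Rmin_l.
      + apply H2, (Rlt_le_trans _ _ _ Hv), Rmin_r.
    - apply (filter_imp (fun z => 0 < z)); [|apply Hpos, HT].
      intros z Hz; apply ex_RInt_pos; try lra.
      intros y Hy; apply (continuous_RInt_section (fun y x => f x y)); try assumption.
      intros u v Hu Hv; apply continuity_2d_pt_swap, Hf; assumption. }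
  assert (HGa : G a = 0) by apply (RInt_point a (fun x => RInt (fun y => f x y) c d)).
  assert (HHa : H a = 0).
  { unfold H; rewrite (RInt_ext _ (fun _ => 0)).
    - rewrite RInt_const; apply (Rmult_0_r (d - c)).
    - intros y _; apply (RInt_point a (fun x => f x y)). }
  destruct Hab as [Hab| <-]; [|exact (eq_trans HGa (eq_sym HHa))].
  assert (Heq : minus (G a) (H a) = minus (G b) (H b)).
  { apply (eq_is_derive (fun T => minus (G T) (H T))); [|exact Hab].
    intros T HT.
    pose proof (is_derive_minus G H T _ _ (HG T ltac:(lra)) (HH T ltac:(lra))) as HGH.
    rewrite minus_eq_zero in HGH; exact HGH. }
  change (G b = H b); unfold minus, plus, opp in Heq; simpl in Heq; lra.
Qed.

(** * Improper integrals and the Gamma function *)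

Lemma RInt_scal_l (f : R -> R) (k a b : R) :
  ex_RInt f a b -> RInt (fun x => k * f x) a b = k * RInt f a b.
Proof. exact (RInt_scal f a b k). Qed.

Lemma ex_RInt_scal_l (f : R -> R) (k a b : R) :
  ex_RInt f a b -> ex_RInt (fun x => k * f x) a b.
Proof. exact (ex_RInt_scal f a b k). Qed.

Lemma RInt_ext_le (f g : R -> R) (a b : R) :
  a <= b -> (forall x, a < x < b -> f x = g x) -> RInt f a b = RInt g a b.
Proof.
  intros Hab Hfg; apply RInt_ext.
  rewrite Rmin_left, Rmax_right by exact Hab; exact Hfg.
Qed.

Lemma RInt_split (f : R -> R) (a b c : R) :
  ex_RInt f a b -> ex_RInt f b c -> RInt f a c = RInt f a b + RInt f b c.
Proof. intros H1 H2; symmetry; apply (RInt_Chasles f a b c H1 H2). Qed.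

Lemma RInt_interval_incr (f : R -> R) (a b a' b' : R) :
  (forall x, 0 < x -> continuous f x) -> (forall x, 0 < x -> 0 <= f x) ->
  0 < a' -> a' <= a -> a <= b -> b <= b' -> RInt f a b <= RInt f a' b'.
Proof.
  intros Hc Hf Ha' Ha Hab Hb.
  assert (Hex : forall u v, 0 < u -> 0 < v -> ex_RInt f u v) by (intros; apply ex_RInt_pos; auto).
  rewrite (RInt_split f a' a b'), (RInt_split f a b b') by (apply Hex; lra).
  assert (0 <= RInt f a' a) by (apply RInt_ge_0; [|apply Hex|intros; apply Hf]; lra).
  assert (0 <= RInt f b b') by (apply RInt_ge_0; [|apply Hex|intros; apply Hf]; lra).
  lra.
Qed.

(** For a nonnegative integrand, proper integrals grow with the interval, so their supremum is their
    limit. *)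
Lemma improper_int_open_lub (f : R -> R) (l : R) :
  (forall x, 0 < x -> continuous f x) -> (forall x, 0 < x -> 0 <= f x) ->
  (forall a b, 0 < a -> a <= b -> RInt f a b <= l) ->
  (forall eps, 0 < eps -> exists a b, 0 < a /\ a <= b /\ l - eps < RInt f a b) ->
  improper_int_open f l.
Proof.
  intros Hc Hf Hub Hlub; split.
  - intros a b Ha Hab; constructor; apply ex_RInt_Reals_0, ex_RInt_pos; auto; lra.
  - intros eps Heps; destruct (Hlub eps Heps) as (a & b & Ha & Hab & Hl).
    (* The definition asks for [d < B] strictly, while [a = b] is possible here. *)
    exists a, (b + 1); repeat split; try lra.
    intros a' b' pr Ha' Haa' Hbb'; rewrite <- RInt_Reals.
    pose proof (Hub a' b' Ha' ltac:(lra)).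
    pose proof (RInt_interval_incr f a b a' b' Hc Hf Ha' ltac:(lra) Hab ltac:(lra)).
    apply Rabs_def1; lra.
Qed.

Lemma improper_int_open_bounded (f : R -> R) (M : R) :
  (forall x, 0 < x -> continuous f x) -> (forall x, 0 < x -> 0 <= f x) ->
  (forall a b, 0 < a -> a <= b -> RInt f a b <= M) ->
  exists l, improper_int_open f l.
Proof.
  intros Hc Hf HM.
  destruct (completeness (fun y => exists a b, 0 < a /\ a <= b /\ y = RInt f a b))
    as [l [Hub Hlub]].
  - exists M; intros y (a & b & Ha & Hab & ->); auto.
  - exists (RInt f 1 1), 1, 1; repeat split; lra.
  - exists l; apply improper_int_open_lub; auto.
    + intros a b Ha Hab; apply Hub; exists a, b; auto.
    + intros eps Heps; apply NNPP; intros Hno.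
      assert (Hl : l <= l - eps); [|lra].
      apply Hlub; intros y (a & b & Ha & Hab & ->).
      apply Rnot_lt_le; intros Hlt; apply Hno; exists a, b; auto.
Qed.

Lemma improper_int_open_approx (f : R -> R) (l eps : R) :
  (forall x, 0 < x -> continuous f x) -> improper_int_open f l -> 0 < eps ->
  exists a b, 0 < a /\ a <= b /\
    forall a' b', 0 < a' -> a' <= a -> b <= b' -> Rabs (RInt f a' b' - l) < eps.
Proof.
  intros Hc [_ Hl] Heps.
  destruct (Hl eps Heps) as (d & B & Hd & HdB & H).
  (* Halving [d] and adding 1 to [B] turn the strict conditions of the definition into weak ones. *)
  assert (Hall : forall a' b', 0 < a' -> a' <= d / 2 -> B + 1 <= b' ->
            Rabs (RInt f a' b' - l) < eps).
  { intros a' b' Ha' Had Hb.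
    assert (Hex : ex_RInt f a' b') by (apply ex_RInt_pos; auto; lra).
    rewrite (RInt_Reals _ _ _ (ex_RInt_Reals_0 _ _ _ Hex)); apply H; lra. }
  exists (d / 2), (B + 1); repeat split; try lra; exact Hall.
Qed.

Lemma improper_int_open_ge (f : R -> R) (l a b : R) :
  (forall x, 0 < x -> continuous f x) -> (forall x, 0 < x -> 0 <= f x) ->
  improper_int_open f l -> 0 < a -> a <= b -> RInt f a b <= l.
Proof.
  intros Hc Hf Hl Ha Hab; apply Rnot_lt_le; intros Hlt.
  destruct (improper_int_open_approx f l (RInt f a b - l) Hc Hl)
    as (a1 & b1 & Ha1 & Hab1 & Happ); [lra|].
  pose proof (Rmin_l a a1); pose proof (Rmin_r a a1).
  pose proof (Rmax_l b b1); pose proof (Rmax_r b b1).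
  assert (Hm : 0 < Rmin a a1) by (apply Rmin_glb_lt; lra).
  specialize (Happ (Rmin a a1) (Rmax b b1) Hm ltac:(lra) ltac:(lra)).
  pose proof (RInt_interval_incr f a b (Rmin a a1) (Rmax b b1) Hc Hf
                Hm ltac:(lra) Hab ltac:(lra)).
  apply Rabs_def2 in Happ; lra.
Qed.

(** * Power integrals and convergence of the Gamma integral *)

Lemma is_derive_Rpower (p x : R) :
  0 < x -> is_derive (fun x => Rpower x p) x (p * Rpower x (p - 1)).
Proof. intros Hx; apply is_derive_Reals, derivable_pt_lim_power, Hx. Qed.

Lemma continuous_Rpower (p x : R) : 0 < x -> continuous (fun x => Rpower x p) x.
Proof.
  intros Hx; apply (ex_derive_continuous (fun x => Rpower x p)).
  eexists; apply is_derive_Rpower, Hx.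
Qed.

Lemma Rpower_pos (x p : R) : 0 < Rpower x p.
Proof. apply exp_pos. Qed.

Lemma RInt_Rpower (p a b : R) :
  p <> -1 -> 0 < a -> a <= b ->
  RInt (fun x => Rpower x p) a b = (Rpower b (p + 1) - Rpower a (p + 1)) / (p + 1).
Proof.
  intros Hp Ha Hab; assert (Hp1 : p + 1 <> 0) by lra.
  apply is_RInt_unique.
  replace ((Rpower b (p + 1) - Rpower a (p + 1)) / (p + 1))
    with (minus (Rpower b (p + 1) / (p + 1)) (Rpower a (p + 1) / (p + 1)))
    by (unfold minus, plus, opp; simpl; field; exact Hp1).
  apply (is_RInt_derive (fun x => Rpower x (p + 1) / (p + 1)));
    rewrite Rmin_left by exact Hab; intros x [Hx _].
  - replace (Rpower x p) with (/ (p + 1) * ((p + 1) * Rpower x (p + 1 - 1)))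
      by (replace (p + 1 - 1) with p by ring; field; exact Hp1).
    apply (is_derive_ext (fun x => / (p + 1) * Rpower x (p + 1)));
      [intros; apply Rmult_comm|].
    apply (is_derive_scal (fun x => Rpower x (p + 1))), is_derive_Rpower; lra.
  - apply continuous_Rpower; lra.
Qed.

Definition gamma_integrand (x s : R) : R := Rpower s (x - 1) * exp (- s).

Lemma gamma_integrand_pos (x s : R) : 0 < gamma_integrand x s.
Proof. apply Rmult_lt_0_compat; apply exp_pos. Qed.

Lemma continuous_gamma_integrand (x s : R) : 0 < s -> continuous (gamma_integrand x) s.
Proof.
  intros Hs; apply (continuous_mult (fun s => Rpower s (x - 1)) (fun s => exp (- s))).
  - apply continuous_Rpower, Hs.
  - apply (continuous_exp_comp (fun s => - s)), (continuous_opp (fun s : R => s)).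
    apply continuous_id.
Qed.

(** The constant is the maximum of s^(x+1) exp (- s), attained at s = x + 1; the proof is the
    tangent inequality ln z <= z - 1 at z = s / (x + 1). *)
Lemma gamma_integrand_decay (x s : R) :
  0 < x -> 0 < s ->
  gamma_integrand x s <= exp ((x + 1) * (ln (x + 1) - 1)) * Rpower s (- 2).
Proof.
  intros Hx Hs; unfold gamma_integrand, Rpower; rewrite <- !exp_plus.
  apply exp_le_compat.
  assert (Hln : ln (s / (x + 1)) <= s / (x + 1) - 1).
  { pose proof (exp_ineq1_le (ln (s / (x + 1)))) as H.
    rewrite exp_ln in H by (apply Rdiv_lt_0_compat; lra); lra. }
  rewrite ln_div in Hln by lra.
  apply Rmult_le_compat_l with (r := x + 1) in Hln; [|lra].
  replace ((x + 1) * (s / (x + 1) - 1)) with (s - (x + 1)) in Hln by (field; lra).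
  lra.
Qed.

Lemma Gamma_spec (x : R) : 0 < x -> improper_int_open (gamma_integrand x) (Gamma x).
Proof.
  intros Hx; unfold Gamma.
  apply (epsilon_spec (inhabits 0) (improper_int_open (gamma_integrand x))).
  set (C := exp ((x + 1) * (ln (x + 1) - 1))).
  assert (HC : 0 < C) by apply exp_pos.
  assert (Hge : forall s, 0 < s -> 0 <= gamma_integrand x s)
    by (intros; apply Rlt_le, gamma_integrand_pos).
  assert (Hex : forall a b, 0 < a -> 0 < b -> ex_RInt (gamma_integrand x) a b)
    by (intros; apply ex_RInt_pos; auto using continuous_gamma_integrand).
  assert (Hexp : forall p a b, 0 < a -> 0 < b -> ex_RInt (fun s => Rpower s p) a b)
    by (intros; apply ex_RInt_pos; auto using continuous_Rpower).
  (* [/ x] bounds the integral of s^(x-1) over (0, 1), and [C] that of C s^(-2) over (1, oo). *)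
  apply (improper_int_open_bounded _ (/ x + C)); auto using continuous_gamma_integrand.
  intros a b Ha Hab.
  pose proof (Rmin_l a 1); pose proof (Rmin_r a 1).
  pose proof (Rmax_l b 1); pose proof (Rmax_r b 1).
  assert (Hm : 0 < Rmin a 1) by (apply Rmin_glb_lt; lra).
  apply Rle_trans with (RInt (gamma_integrand x) (Rmin a 1) (Rmax b 1)).
  { apply RInt_interval_incr; auto using continuous_gamma_integrand; lra. }
  rewrite (RInt_split _ _ 1) by (apply Hex; lra).
  apply Rplus_le_compat.
  - apply Rle_trans with (RInt (fun s => Rpower s (x - 1)) (Rmin a 1) 1).
    + apply RInt_le; [lra | apply Hex; lra | apply Hexp; lra |].
      intros s Hs; unfold gamma_integrand.
      rewrite <- (Rmult_1_r (Rpower s (x - 1))) at 2.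
      apply Rmult_le_compat_l; [apply Rlt_le, Rpower_pos|].
      rewrite <- exp_0; apply exp_le_compat; lra.
    + rewrite RInt_Rpower by lra.
      replace (x - 1 + 1) with x by ring.
      unfold Rpower at 1; rewrite ln_1, Rmult_0_r, exp_0.
      pose proof (Rpower_pos (Rmin a 1) x).
      rewrite <- (Rmult_1_l (/ x)); apply Rmult_le_compat_r; [|lra].
      apply Rlt_le, Rinv_0_lt_compat, Hx.
  - apply Rle_trans with (RInt (fun s => C * Rpower s (- 2)) 1 (Rmax b 1)).
    + apply RInt_le; [lra | apply Hex; lra | apply ex_RInt_scal_l, Hexp; lra |].
      intros s Hs; apply gamma_integrand_decay; lra.
    + rewrite RInt_scal_l by (apply Hexp; lra).
      rewrite RInt_Rpower by lra.
      replace (- 2 + 1) with (- 1) by ring.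
      unfold Rpower at 2; rewrite ln_1, Rmult_0_r, exp_0.
      pose proof (Rpower_pos (Rmax b 1) (- 1)).
      rewrite <- (Rmult_1_r C) at 2; apply Rmult_le_compat_l; lra.
Qed.

Lemma RInt_gamma_le_Gamma (x a b : R) :
  0 < x -> 0 < a -> a <= b -> RInt (gamma_integrand x) a b <= Gamma x.
Proof.
  intros Hx Ha Hab; apply improper_int_open_ge; auto using Gamma_spec, continuous_gamma_integrand.
  intros; apply Rlt_le, gamma_integrand_pos.
Qed.

Lemma RInt_gamma_approx (x eps : R) :
  0 < x -> 0 < eps -> exists p q, 0 < p /\ p <= q /\
    forall p' q', 0 < p' -> p' <= p -> q <= q' ->
      Gamma x - eps < RInt (gamma_integrand x) p' q'.
Proof.
  intros Hx Heps.
  destruct (improper_int_open_approx (gamma_integrand x) (Gamma x) eps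
     (continuous_gamma_integrand x) (Gamma_spec x Hx) Heps) as (p & q & Hp & Hpq & H).
  exists p, q; repeat split; auto.
  intros p' q' H1 H2 H3; specialize (H p' q' H1 H2 H3); apply Rabs_def2 in H; lra.
Qed.

Lemma Gamma_pos (x : R) : 0 < x -> 0 < Gamma x.
Proof.
  intros Hx; apply Rlt_le_trans with (RInt (gamma_integrand x) 1 2).
  - apply RInt_gt_0; [lra | intros; apply gamma_integrand_pos |].
    intros s Hs; apply continuous_gamma_integrand; lra.
  - apply RInt_gamma_le_Gamma; lra.
Qed.

Lemma RInt_dilate (f : R -> R) (k a b : R) :
  ex_RInt f (k * a) (k * b) ->
  RInt (fun s => k * f (k * s)) a b = RInt f (k * a) (k * b).
Proof.
  intros Hf; pose proof (RInt_comp_lin f k 0 a b) as H.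
  rewrite !Rplus_0_r in H; rewrite <- (H Hf).
  apply RInt_ext; intros s _; rewrite Rplus_0_r; reflexivity.
Qed.

(** * The beta integral *)

(** The integrand u^(a-1) (1-u)^(b-1) of B(a, b), carried to the half-line by u = s / (1 + s). *)
Definition beta_integrand (a b s : R) : R := Rpower s (a - 1) * Rpower (1 + s) (- (a + b)).

Lemma beta_integrand_pos (a b s : R) : 0 < beta_integrand a b s.
Proof. apply Rmult_lt_0_compat; apply exp_pos. Qed.

Lemma continuous_beta_integrand (a b s : R) : 0 < s -> continuous (beta_integrand a b) s.
Proof.
  intros Hs; apply (continuous_mult (fun s => Rpower s (a - 1))
                      (fun s => Rpower (1 + s) (- (a + b)))).
  - apply continuous_Rpower, Hs.
  - apply (continuous_comp (fun s => 1 + s) (fun z => Rpower z (- (a + b)))).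
    + apply (continuous_plus (fun _ => 1) (fun s : R => s));
        [apply continuous_const | apply continuous_id].
    + apply continuous_Rpower; lra.
Qed.

(* Integrated first in [s] it gives the integrand of Gamma(b) times Gamma(a),
   integrated first in [y] the beta integrand times Gamma(a + b). *)
Definition beta_kernel (a b s y : R) : R :=
  Rpower s (a - 1) * Rpower y (a + b - 1) * exp (- (y * (1 + s))).

Lemma continuity_2d_beta_kernel (a b s y : R) :
  0 < s -> 0 < y -> continuity_2d_pt (beta_kernel a b) s y.
Proof.
  intros Hs Hy; unfold beta_kernel.
  assert (HP : forall p z, 0 < z -> continuity_pt (fun z => Rpower z p) z).
  { intros p z Hz; apply continuity_pt_filterlim, continuous_Rpower, Hz. }
  apply continuity_2d_pt_mult; [apply continuity_2d_pt_mult|].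
  - apply (continuity_1d_2d_pt_comp (fun z => Rpower z (a - 1)) (fun u _ => u));
      [apply HP, Hs | apply continuity_2d_pt_id1].
  - apply (continuity_1d_2d_pt_comp (fun z => Rpower z (a + b - 1)) (fun _ v => v));
      [apply HP, Hy | apply continuity_2d_pt_id2].
  - apply (continuity_1d_2d_pt_comp exp (fun u v => - (v * (1 + u)))).
    + apply derivable_continuous_pt, derivable_pt_exp.
    + apply continuity_2d_pt_opp, continuity_2d_pt_mult; [apply continuity_2d_pt_id2|].
      apply continuity_2d_pt_plus; [apply continuity_2d_pt_const | apply continuity_2d_pt_id1].
Qed.

Lemma RInt_beta_kernel_s (a b eta K y : R) :
  0 < eta -> eta <= K -> 0 < y ->
  RInt (fun s => beta_kernel a b s y) eta K =
  gamma_integrand b y * RInt (gamma_integrand a) (y * eta) (y * K).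
Proof.
  intros Heta HK Hy.
  assert (Hex : ex_RInt (gamma_integrand a) (y * eta) (y * K)).
  { apply ex_RInt_pos; [apply continuous_gamma_integrand | |]; apply Rmult_lt_0_compat; lra. }
  assert (Hex' : ex_RInt (fun s => y * gamma_integrand a (y * s)) eta K).
  { apply ex_RInt_pos; try lra; intros s Hs.
    apply (continuous_mult (fun _ => y) (fun s => gamma_integrand a (y * s)));
      [apply continuous_const|].
    apply (continuous_comp (fun s => y * s) (gamma_integrand a)).
    - apply (continuous_mult (fun _ => y) (fun s : R => s));
        [apply continuous_const | apply continuous_id].
    - apply continuous_gamma_integrand, Rmult_lt_0_compat; assumption. }
  rewrite <- RInt_dilate, <- RInt_scal_l by assumption.
  apply RInt_ext_le; [exact HK|]; intros s [Hs _].
  unfold beta_kernel, gamma_integrand.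
  rewrite <- Rpower_mult_distr by lra.
  (* The three exponents go to the integrand of Gamma(b), to the dilated argument [y * s], and to
     the Jacobian [y]. *)
  replace (a + b - 1) with ((b - 1) + ((a - 1) + 1)) by ring.
  rewrite (Rpower_plus (b - 1)), (Rpower_plus (a - 1)), Rpower_1 by exact Hy.
  replace (- (y * (1 + s))) with (- y + - (y * s)) by ring.
  rewrite exp_plus; ring.
Qed.

Lemma RInt_beta_kernel_y (a b p q s : R) :
  0 < p -> p <= q -> 0 < s ->
  RInt (fun y => beta_kernel a b s y) p q =
  beta_integrand a b s * RInt (gamma_integrand (a + b)) ((1 + s) * p) ((1 + s) * q).
Proof.
  intros Hp Hq Hs.
  assert (Hex : ex_RInt (gamma_integrand (a + b)) ((1 + s) * p) ((1 + s) * q)).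
  { apply ex_RInt_pos; [apply continuous_gamma_integrand | |]; apply Rmult_lt_0_compat; lra. }
  assert (Hex' : ex_RInt (fun y => (1 + s) * gamma_integrand (a + b) ((1 + s) * y)) p q).
  { apply ex_RInt_pos; try lra; intros y Hy.
    apply (continuous_mult (fun _ => 1 + s) (fun y => gamma_integrand (a + b) ((1 + s) * y)));
      [apply continuous_const|].
    apply (continuous_comp (fun y => (1 + s) * y) (gamma_integrand (a + b))).
    - apply (continuous_mult (fun _ => 1 + s) (fun y : R => y));
        [apply continuous_const | apply continuous_id].
    - apply continuous_gamma_integrand, Rmult_lt_0_compat; lra. }
  rewrite <- RInt_dilate, <- RInt_scal_l by assumption.
  apply RInt_ext_le; [exact Hq|]; intros y [Hy _].
  unfold beta_kernel, beta_integrand, gamma_integrand.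
  rewrite <- Rpower_mult_distr by lra.
  (* The beta factor exactly cancels the Jacobian and the power of [1 + s] produced by the
     dilation. *)
  assert (Hone : Rpower (1 + s) (- (a + b)) * (1 + s) * Rpower (1 + s) (a + b - 1) = 1).
  { rewrite <- (Rpower_1 (1 + s)) at 2 by lra.
    rewrite <- !Rpower_plus.
    replace (- (a + b) + 1 + (a + b - 1)) with 0 by ring; apply Rpower_O; lra. }
  replace (y * (1 + s)) with ((1 + s) * y) by ring.
  transitivity (Rpower s (a - 1) * Rpower y (a + b - 1) * exp (- ((1 + s) * y)) *
    (Rpower (1 + s) (- (a + b)) * (1 + s) * Rpower (1 + s) (a + b - 1))).
  - rewrite Hone; ring.
  - ring.
Qed.

Lemma ex_RInt_beta (a b eta K : R) :
  0 < eta -> 0 < K -> ex_RInt (beta_integrand a b) eta K.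
Proof. intros; apply ex_RInt_pos; auto using continuous_beta_integrand. Qed.

Lemma ex_RInt_gamma (x a b : R) :
  0 < a -> 0 < b -> ex_RInt (gamma_integrand x) a b.
Proof. intros; apply ex_RInt_pos; auto using continuous_gamma_integrand. Qed.

(** With [[eta, K]] fixed, [[p, q]] is taken so large that the inner [y]-integral nearly reaches
    Gamma(a + b) for every [s]. In the other order the double integral is at most Gamma(a)
    Gamma(b). *)
Lemma RInt_beta_upper (a b eta K : R) :
  0 < a -> 0 < b -> 0 < eta -> eta <= K ->
  RInt (beta_integrand a b) eta K * Gamma (a + b) <= Gamma a * Gamma b.
Proof.
  intros Ha Hb Heta HK; set (B := RInt (beta_integrand a b) eta K).
  assert (HB : 0 <= B).
  { apply RInt_ge_0; [exact HK | apply ex_RInt_beta; lra |].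
    intros; apply Rlt_le, beta_integrand_pos. }
  assert (HGa := Gamma_pos a Ha).
  apply le_epsilon; intros eps Heps.
  assert (Heps' : 0 < eps / (B + 1)) by (apply Rdiv_lt_0_compat; lra).
  destruct (RInt_gamma_approx (a + b) (eps / (B + 1))) as (p' & q' & Hp' & Hpq' & Happ);
    [lra | lra |].
  (* Worst cases of [1 + s]: these make [[(1 + s) p, (1 + s) q]] contain [[p', q']] for all [s] in
     [[eta, K]]. *)
  set (p := p' / (1 + K)); set (q := q' / (1 + eta)).
  assert (Hp : 0 < p) by (apply Rdiv_lt_0_compat; lra).
  assert (HpK : (1 + K) * p = p') by (unfold p; field; lra).
  assert (Hqe : (1 + eta) * q = q') by (unfold q; field; lra).
  assert (Hpq : p <= q) by nra.
  assert (Hlow : (Gamma (a + b) - eps / (B + 1)) * B <=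
                 RInt (fun s => RInt (fun y => beta_kernel a b s y) p q) eta K).
  { unfold B; rewrite <- RInt_scal_l by (apply ex_RInt_beta; lra).
    apply RInt_le; [exact HK | apply ex_RInt_scal_l, ex_RInt_beta; lra | |].
    - apply ex_RInt_pos; try lra; intros s Hs.
      apply continuous_RInt_section; try lra.
      intros; apply continuity_2d_beta_kernel; assumption.
    - intros s Hs; rewrite RInt_beta_kernel_y by lra.
      rewrite Rmult_comm; apply Rmult_le_compat_l; [apply Rlt_le, beta_integrand_pos|].
      apply Rlt_le, Happ; [apply Rmult_lt_0_compat| |]; nra. }
  rewrite Fubini_rectangle in Hlow;
    [|intros; apply continuity_2d_beta_kernel; assumption|lra..].
  assert (Hup : RInt (fun y => RInt (fun s => beta_kernel a b s y) eta K) p q <=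
                Gamma a * Gamma b).
  { apply Rle_trans with (RInt (fun y => Gamma a * gamma_integrand b y) p q).
    - apply RInt_le; [exact Hpq | | apply ex_RInt_scal_l, ex_RInt_gamma; lra |].
      + apply ex_RInt_pos; try lra; intros y Hy.
        apply (continuous_RInt_section (fun y s => beta_kernel a b s y)); try lra.
        intros; apply continuity_2d_pt_swap, continuity_2d_beta_kernel; assumption.
      + intros y Hy; rewrite RInt_beta_kernel_s, Rmult_comm by lra.
        apply Rmult_le_compat_r; [apply Rlt_le, gamma_integrand_pos|].
        apply RInt_gamma_le_Gamma; [exact Ha | apply Rmult_lt_0_compat; lra | nra].
    - rewrite RInt_scal_l by (apply ex_RInt_gamma; lra).
      apply Rmult_le_compat_l; [lra|]; apply RInt_gamma_le_Gamma; lra. }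
  assert (Hsmall : eps / (B + 1) * B <= eps).
  { apply Rmult_le_reg_r with (B + 1); [lra|].
    replace (eps / (B + 1) * B * (B + 1)) with (eps * B) by (field; lra); nra. }
  lra.
Qed.

(** The mirror image of the upper bound: [[p, q]] is fixed by Gamma(b), and [[eta, K]] is then taken
    so large that the inner [s]-integral nearly reaches Gamma(a). *)
Lemma RInt_beta_lower (a b eps : R) :
  0 < a -> 0 < b -> 0 < eps ->
  exists eta K, 0 < eta /\ eta <= K /\
    Gamma a * Gamma b - eps < RInt (beta_integrand a b) eta K * Gamma (a + b).
Proof.
  intros Ha Hb Heps.
  assert (HGa := Gamma_pos a Ha); assert (HGb := Gamma_pos b Hb).
  (* [e <= Gamma a] keeps Gamma a - e nonnegative as a multiplier; the other term bounds by [eps]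
     the loss e (Gamma a + Gamma b) in the product. *)
  set (e := Rmin (Gamma a) (eps / (Gamma a + Gamma b))).
  assert (He0 : 0 < eps / (Gamma a + Gamma b)) by (apply Rdiv_lt_0_compat; lra).
  assert (He : 0 < e) by (apply Rmin_glb_lt; assumption).
  assert (Hea : e <= Gamma a) by apply Rmin_l.
  assert (Hee : e * (Gamma a + Gamma b) <= eps).
  { apply Rle_trans with (eps / (Gamma a + Gamma b) * (Gamma a + Gamma b)).
    - apply Rmult_le_compat_r; [lra | apply Rmin_r].
    - right; field; lra. }
  destruct (RInt_gamma_approx b e Hb He) as (p & q & Hp & Hpq & Happb).
  destruct (RInt_gamma_approx a e Ha He) as (p' & q' & Hp' & Hpq' & Happa).
  (* Worst cases of [y]: these make [[y eta, y K]] contain [[p', q']] for all [y] in [[p, q]]. *)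
  set (eta := p' / q); set (K := q' / p).
  assert (Heta : 0 < eta) by (apply Rdiv_lt_0_compat; lra).
  assert (Hqe : q * eta = p') by (unfold eta; field; lra).
  assert (HpK : p * K = q') by (unfold K; field; lra).
  assert (HK : eta <= K) by nra.
  exists eta, K; repeat split; [exact Heta | exact HK |].
  assert (Hlow : (Gamma a - e) * RInt (gamma_integrand b) p q <=
                 RInt (fun y => RInt (fun s => beta_kernel a b s y) eta K) p q).
  { rewrite <- RInt_scal_l by (apply ex_RInt_gamma; lra).
    apply RInt_le; [exact Hpq | apply ex_RInt_scal_l, ex_RInt_gamma; lra | |].
    - apply ex_RInt_pos; try lra; intros y Hy.
      apply (continuous_RInt_section (fun y s => beta_kernel a b s y)); try lra.
      intros; apply continuity_2d_pt_swap, continuity_2d_beta_kernel; assumption.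
    - intros y Hy; rewrite RInt_beta_kernel_s, Rmult_comm by lra.
      apply Rmult_le_compat_l; [apply Rlt_le, gamma_integrand_pos|].
      apply Rlt_le, Happa; [apply Rmult_lt_0_compat| |]; nra. }
  rewrite <- (Fubini_rectangle (beta_kernel a b)) in Hlow;
    [|intros; apply continuity_2d_beta_kernel; assumption|lra..].
  assert (Hup : RInt (fun s => RInt (fun y => beta_kernel a b s y) p q) eta K <=
                Gamma (a + b) * RInt (beta_integrand a b) eta K).
  { rewrite <- RInt_scal_l by (apply ex_RInt_beta; lra).
    apply RInt_le; [exact HK | | apply ex_RInt_scal_l, ex_RInt_beta; lra |].
    - apply ex_RInt_pos; try lra; intros s Hs.
      apply continuous_RInt_section; try lra.
      intros; apply continuity_2d_beta_kernel; assumption.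
    - intros s Hs; rewrite RInt_beta_kernel_y, Rmult_comm by lra.
      apply Rmult_le_compat_r; [apply Rlt_le, beta_integrand_pos|].
      apply RInt_gamma_le_Gamma; [lra | apply Rmult_lt_0_compat; lra | nra]. }
  pose proof (Happb p q Hp (Rle_refl p) (Rle_refl q)) as Hb'.
  assert (Hprod : (Gamma a - e) * (Gamma b - e) <=
                  (Gamma a - e) * RInt (gamma_integrand b) p q).
  { apply Rmult_le_compat_l; lra. }
  nra.
Qed.

Lemma improper_int_open_beta (a b : R) :
  0 < a -> 0 < b ->
  improper_int_open (beta_integrand a b) (Gamma a * Gamma b / Gamma (a + b)).
Proof.
  intros Ha Hb; assert (HG := Gamma_pos (a + b) ltac:(lra)).
  assert (Hcancel : Gamma a * Gamma b / Gamma (a + b) * Gamma (a + b) = Gamma a * Gamma b)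
    by (field; lra).
  apply improper_int_open_lub.
  - intros; apply continuous_beta_integrand; assumption.
  - intros; apply Rlt_le, beta_integrand_pos.
  - intros eta K Heta HK; apply Rmult_le_reg_r with (Gamma (a + b)); [exact HG|].
    rewrite Hcancel; apply RInt_beta_upper; assumption.
  - intros eps Heps.
    destruct (RInt_beta_lower a b (eps * Gamma (a + b))) as (eta & K & Heta & HK & H);
      [assumption.. | apply Rmult_lt_0_compat; assumption |].
    exists eta, K; repeat split; [exact Heta | exact HK |].
    apply Rmult_lt_reg_r with (Gamma (a + b)); [exact HG|].
    rewrite Rmult_minus_distr_r, Hcancel; exact H.
Qed.

(** * Autocorrelation of a regularly varying function *)

Lemma ex_RInt_cont (f : R -> R) (a b : R) :
  (forall x, continuous f x) -> ex_RInt f a b.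
Proof.
  intros Hf; apply (ex_RInt_continuous (V := R_CompleteNormedModule)); intros; apply Hf.
Qed.

Lemma RInt_upper_incr (f : R -> R) (a b c : R) :
  (forall x, continuous f x) -> (forall x, 0 <= f x) -> b <= c ->
  RInt f a b <= RInt f a c.
Proof.
  intros Hc Hf Hbc; rewrite (RInt_split f a b c) by (apply ex_RInt_cont, Hc).
  assert (0 <= RInt f b c); [|lra].
  apply RInt_ge_0; auto using ex_RInt_cont.
Qed.

Lemma improper_int_0_inf_bounded (f : R -> R) (M : R) :
  (forall x, continuous f x) -> (forall x, 0 <= f x) ->
  (forall b, RInt f 0 b <= M) -> exists l, improper_int_0_inf f l.
Proof.
  intros Hc Hf HM.
  destruct (completeness (fun y => exists b, y = RInt f 0 b)) as [l [Hub Hlub]].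
  - exists M; intros y [b ->]; apply HM.
  - exists (RInt f 0 0), 0; reflexivity.
  - exists l; split.
    + intros b _; constructor; apply ex_RInt_Reals_0, ex_RInt_cont, Hc.
    + intros eps Heps.
      assert (Hb0 : exists b0, l - eps < RInt f 0 b0).
      { apply NNPP; intros Hno; assert (Hl : l <= l - eps); [|lra].
        apply Hlub; intros y [b ->]; apply Rnot_lt_le; intros Hlt.
        apply Hno; exists b; exact Hlt. }
      destruct Hb0 as [b0 Hb0].
      exists (Rmax 1 b0); split; [pose proof (Rmax_l 1 b0); lra|].
      intros b pr Hb; rewrite <- RInt_Reals.
      pose proof (RInt_upper_incr f 0 b0 b Hc Hf ltac:(pose proof (Rmax_r 1 b0); lra)).
      assert (RInt f 0 b <= l) by (apply Hub; exists b; reflexivity).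
      apply Rabs_def1; lra.
Qed.

Lemma improper_int_0_inf_limit (f : R -> R) (l eps : R) :
  (forall x, continuous f x) -> improper_int_0_inf f l -> 0 < eps ->
  exists B, forall b, B < b -> Rabs (RInt f 0 b - l) < eps.
Proof.
  intros Hc [_ Hl] Heps; destruct (Hl eps Heps) as (B & _ & H).
  exists B; intros b Hb.
  rewrite (RInt_Reals _ _ _ (ex_RInt_Reals_0 _ _ _ (ex_RInt_cont f 0 b Hc))).
  apply H, Hb.
Qed.

Lemma improper_int_0_inf_ge (f : R -> R) (l b : R) :
  (forall x, continuous f x) -> (forall x, 0 <= f x) ->
  improper_int_0_inf f l -> RInt f 0 b <= l.
Proof.
  intros Hc Hf Hl; apply Rnot_lt_le; intros Hlt.
  destruct (improper_int_0_inf_limit f l (RInt f 0 b - l) Hc Hl) as [B HB]; [lra|].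
  specialize (HB (Rmax b B + 1)).
  pose proof (Rmax_l b B); pose proof (Rmax_r b B).
  pose proof (RInt_upper_incr f 0 b (Rmax b B + 1) Hc Hf ltac:(lra)).
  specialize (HB ltac:(lra)); apply Rabs_def2 in HB; lra.
Qed.

Lemma improper_int_0_inf_le (f : R -> R) (l M B : R) :
  (forall x, continuous f x) -> improper_int_0_inf f l ->
  (forall b, B <= b -> RInt f 0 b <= M) -> l <= M.
Proof.
  intros Hc Hl HM; apply Rnot_lt_le; intros Hlt.
  destruct (improper_int_0_inf_limit f l (l - M) Hc Hl) as [B' HB]; [lra|].
  specialize (HB (Rmax B B' + 1)); specialize (HM (Rmax B B' + 1)).
  pose proof (Rmax_l B B'); pose proof (Rmax_r B B').
  specialize (HB ltac:(lra)); specialize (HM ltac:(lra)); apply Rabs_def2 in HB; lra.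
Qed.

Lemma Rpower_antitone (x y p : R) : p <= 0 -> 0 < x -> x <= y -> Rpower y p <= Rpower x p.
Proof.
  intros Hp Hx Hxy; apply exp_le_compat.
  pose proof (ln_le x y Hx Hxy); nra.
Qed.

Lemma Rpower_le_1 (x p : R) : p <= 0 -> 1 <= x -> Rpower x p <= 1.
Proof.
  intros Hp Hx; apply Rle_trans with (Rpower 1 p); [apply Rpower_antitone; lra|].
  unfold Rpower; rewrite ln_1, Rmult_0_r, exp_0; lra.
Qed.

Lemma Rpower_small (p e : R) :
  0 < p -> 0 < e -> exists x0, 0 < x0 /\ forall x, 0 < x -> x <= x0 -> Rpower x p <= e.
Proof.
  intros Hp He; exists (Rpower e (/ p)); split; [apply Rpower_pos|].
  intros x Hx Hle; apply Rle_trans with (Rpower (Rpower e (/ p)) p).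
  - apply Rle_Rpower_l; lra.
  - rewrite Rpower_mult, Rinv_l, Rpower_1; lra.
Qed.

Lemma RInt_rescale (g : R -> R) (t a b : R) :
  (forall x, 0 < x -> continuous g x) -> 0 < t -> 0 < a -> a <= b ->
  ex_RInt (fun s => g (s / t)) (t * a) (t * b) /\
  RInt (fun s => g (s / t)) (t * a) (t * b) = t * RInt g a b.
Proof.
  intros Hg Ht Ha Hab.
  assert (Hex : forall c, ex_RInt (fun s => c * g (/ t * s)) (t * a) (t * b)).
  { intros c; apply ex_RInt_pos; [|apply Rmult_lt_0_compat; lra..].
    intros s Hs.
    apply (continuous_mult (fun _ => c) (fun s => g (/ t * s))); [apply continuous_const|].
    apply (continuous_comp (fun s => / t * s) g).
    - apply (continuous_mult (fun _ => / t) (fun s : R => s));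
        [apply continuous_const | apply continuous_id].
    - apply Hg, Rmult_lt_0_compat; [apply Rinv_0_lt_compat, Ht | exact Hs]. }
  assert (Hta : / t * (t * a) = a) by (field; lra).
  assert (Htb : / t * (t * b) = b) by (field; lra).
  assert (Hle : t * a <= t * b) by (apply Rmult_le_compat_l; lra).
  assert (Heq : forall s, 1 * g (/ t * s) = g (s / t)).
  { intros s; rewrite Rmult_1_l, Rmult_comm; reflexivity. }
  split.
  - apply (ex_RInt_ext (fun s => 1 * g (/ t * s))); [intros; apply Heq | apply Hex].
  - pose proof (RInt_dilate g (/ t) (t * a) (t * b)) as H.
    rewrite Hta, Htb in H; rewrite <- H by (apply ex_RInt_pos; auto; lra).
    rewrite <- RInt_scal_l by apply Hex.
    apply RInt_ext_le; [exact Hle|]; intros s _; rewrite <- Heq; field; lra.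
Qed.

Lemma continuous_autocorrelation_integrand (r : R -> R) (t : R) :
  (forall x, continuous r x) -> forall x, continuous (fun s => r s * r (s + t)) x.
Proof.
  intros Hc x; apply (continuous_mult r (fun s => r (s + t))); [apply Hc|].
  apply (continuous_comp (fun s => s + t) r); [|apply Hc].
  apply (continuous_plus (fun s : R => s) (fun _ => t));
    [apply continuous_id | apply continuous_const].
Qed.

Lemma Rmult_le_sq_compat (x y a b u v : R) :
  0 <= x -> 0 <= y -> x <= a * (b * u) -> y <= a * (b * v) ->
  x * y <= a ^ 2 * b ^ 2 * (u * v).
Proof.
  intros Hx Hy H1 H2; replace (a ^ 2 * b ^ 2 * (u * v)) with (a * (b * u) * (a * (b * v)))
    by ring.
  apply Rmult_le_compat; assumption.
Qed.

(** * Potter estimates for the start, the head and the tail of the autocorrelation integral *)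

Section PotterEstimates.

Variables (r : R -> R) (mu d X : R).
Hypothesis r_cont : forall x, continuous r x.
Hypothesis r_pos : forall x, 0 < r x.
Hypothesis X_pos : 0 < X.
Hypothesis potter : potter_bounds r mu d X.
Hypothesis d_le : mu + d <= 0.

(** [q] is the power of [s] in the tail bound, integrable at infinity by [q_lt]. [p] is one more
    than the power in the head bound, integrable at zero by [p_gt]. *)
Notation q := (2 * (mu + d)).
Notation p := (mu - d + 1).
Hypothesis q_lt : q < -1.
Hypothesis p_gt : 0 < p.

Notation F t := (fun s => r s * r (s + t)).

Lemma ex_RInt_autocorrelation (t a b : R) : ex_RInt (F t) a b.
Proof. apply ex_RInt_cont, continuous_autocorrelation_integrand, r_cont. Qed.

Lemma potter_shift_le (s t : R) : X <= t -> 0 <= s -> r (s + t) <= exp d * r t.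
Proof.
  intros Ht Hs; destruct (potter t (s + t) Ht ltac:(lra)) as [H _].
  apply (Rle_trans _ _ _ H), Rmult_le_compat_l; [apply Rlt_le, exp_pos|].
  rewrite <- (Rmult_1_r (r t)) at 2.
  apply Rmult_le_compat_l; [apply Rlt_le, r_pos|].
  apply Rpower_le_1; [exact d_le|].
  apply Rmult_le_reg_r with t; [lra|]; unfold Rdiv; rewrite Rmult_assoc, Rinv_l; lra.
Qed.

(** The base point [u] is independent of the lag [t]: [u = t] serves the limit, and [u = X], [K = 1]
    serves finiteness for every lag. *)
Lemma autocorrelation_tail_le (u t K b : R) :
  X <= u -> 0 <= t -> 1 <= K -> u * K <= b ->
  RInt (F t) (u * K) b <= u * (r u) ^ 2 * (exp d ^ 2 * Rpower K (q + 1) / - (q + 1)).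
Proof.
  intros Hu Ht HK Hb.
  assert (Hu0 : 0 < u) by lra.
  assert (Hbu : u * (b / u) = b) by (field; lra).
  assert (HKb : K <= b / u) by (apply Rmult_le_reg_l with u; lra).
  destruct (RInt_rescale (fun s => Rpower s q) u K (b / u)) as [Hex Heq];
    try lra; [intros; apply continuous_Rpower; assumption|].
  rewrite Hbu in *.
  apply Rle_trans with (RInt (fun s => exp d ^ 2 * r u ^ 2 * Rpower (s / u) q) (u * K) b).
  - apply RInt_le; [exact Hb | apply ex_RInt_autocorrelation | apply ex_RInt_scal_l, Hex |].
    intros s [Hs _]; assert (Hus : u <= s) by nra.
    replace q with (mu + d + (mu + d)) by ring.
    rewrite Rpower_plus; apply Rmult_le_sq_compat; try (apply Rlt_le, r_pos).
    + apply potter; assumption.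
    (* As [mu + d <= 0] and [s + t >= s], the shifted factor obeys the same bound as [r s]. *)
    + destruct (potter u (s + t) Hu ltac:(lra)) as [H _].
      apply (Rle_trans _ _ _ H).
      apply Rmult_le_compat_l; [apply Rlt_le, exp_pos|].
      apply Rmult_le_compat_l; [apply Rlt_le, r_pos|].
      apply Rpower_antitone; [exact d_le | apply Rdiv_lt_0_compat; lra |].
      apply Rmult_le_compat_r; [apply Rlt_le, Rinv_0_lt_compat, Hu0 | lra].
  - rewrite RInt_scal_l, Heq, RInt_Rpower by (exact Hex || lra).
    pose proof (Rpower_pos (b / u) (q + 1)) as Hpb.
    assert (Hur : 0 <= u * r u ^ 2 * exp d ^ 2).
    { apply Rmult_le_pos; [apply Rmult_le_pos; [lra|]|]; apply pow2_ge_0. }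
    replace (exp d ^ 2 * r u ^ 2 *
             (u * ((Rpower (b / u) (q + 1) - Rpower K (q + 1)) / (q + 1))))
      with (u * r u ^ 2 * exp d ^ 2 *
             ((Rpower K (q + 1) - Rpower (b / u) (q + 1)) / - (q + 1))) by (field; lra).
    replace (u * r u ^ 2 * (exp d ^ 2 * Rpower K (q + 1) / - (q + 1)))
      with (u * r u ^ 2 * exp d ^ 2 * (Rpower K (q + 1) / - (q + 1))) by (field; lra).
    apply Rmult_le_compat_l; [exact Hur|].
    apply Rmult_le_compat_r; [apply Rlt_le, Rinv_0_lt_compat; lra | lra].
Qed.

(** Here [X <= s <= t]: the second Potter bound controls [r s], while [r (s + t)] is at most exp d
    times [r t]. *)
Lemma autocorrelation_head_le (t eta : R) :
  X <= t * eta -> 0 < eta <= 1 -> 0 < t ->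
  RInt (F t) X (t * eta) <= t * (r t) ^ 2 * (exp d ^ 2 * Rpower eta p / p).
Proof.
  intros HX Heta Ht.
  assert (HXt : X <= t) by nra.
  assert (HtX : t * (X / t) = X) by (field; lra).
  assert (HXt0 : 0 < X / t) by (apply Rdiv_lt_0_compat; lra).
  assert (HXeta : X / t <= eta) by (apply Rmult_le_reg_l with t; lra).
  destruct (RInt_rescale (fun s => Rpower s (mu - d)) t (X / t) eta) as [Hex Heq];
    try lra; [intros; apply continuous_Rpower; assumption|].
  rewrite HtX in *.
  apply Rle_trans with (RInt (fun s => exp d ^ 2 * r t ^ 2 * Rpower (s / t) (mu - d))
                          X (t * eta)).
  - apply RInt_le; [exact HX | apply ex_RInt_autocorrelation | apply ex_RInt_scal_l, Hex |].
    intros s [Hs Hst]; assert (Hst' : s <= t) by nra.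
    rewrite <- (Rmult_1_r (Rpower (s / t) (mu - d))).
    apply Rmult_le_sq_compat; try (apply Rlt_le, r_pos).
    + apply potter; lra.
    + rewrite Rmult_1_r; apply potter_shift_le; lra.
  - rewrite RInt_scal_l, Heq, RInt_Rpower by (exact Hex || lra).
    pose proof (Rpower_pos (X / t) p) as Hpb.
    replace (exp d ^ 2 * r t ^ 2 * (t * ((Rpower eta p - Rpower (X / t) p) / p)))
      with (t * r t ^ 2 * exp d ^ 2 * ((Rpower eta p - Rpower (X / t) p) / p)) by (field; lra).
    replace (t * r t ^ 2 * (exp d ^ 2 * Rpower eta p / p))
      with (t * r t ^ 2 * exp d ^ 2 * (Rpower eta p / p)) by (field; lra).
    apply Rmult_le_compat_l.
    + apply Rmult_le_pos; [apply Rmult_le_pos; [lra|]|]; apply pow2_ge_0.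
    + apply Rmult_le_compat_r; [apply Rlt_le, Rinv_0_lt_compat; lra | lra].
Qed.

(** Below [X] no Potter bound controls [r s], so its integral stays as a constant and only the
    shifted factor is estimated. *)
Lemma autocorrelation_start_le (t : R) : X <= t -> RInt (F t) 0 X <= exp d * r t * RInt r 0 X.
Proof.
  intros Ht; rewrite <- RInt_scal_l by (apply ex_RInt_cont, r_cont).
  apply RInt_le; [lra | apply ex_RInt_autocorrelation | apply ex_RInt_scal_l, ex_RInt_cont, r_cont |].
  intros s Hs; rewrite Rmult_comm; apply Rmult_le_compat_r; [apply Rlt_le, r_pos|].
  apply potter_shift_le; lra.
Qed.

(** Makes the start negligible after division by [t * r t ^ 2]. The second Potter bound from [X] to
    [t] says that [t * r t] is at least a positive constant times (t / X)^p. *)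
Lemma id_mul_r_unbounded (M : R) : exists T, forall t, T <= t -> M <= t * r t.
Proof.
  (* [M] may be nonpositive, whereas the threshold below divides by [Y]. *)
  set (Y := Rmax 1 M).
  assert (HY1 : 1 <= Y) by apply Rmax_l.
  assert (HYM : M <= Y) by apply Rmax_r.
  assert (He : 0 < X * r X / (exp d * Y)).
  { apply Rdiv_lt_0_compat; apply Rmult_lt_0_compat; try lra; [apply r_pos | apply exp_pos]. }
  destruct (Rpower_small p _ p_gt He) as (x0 & Hx0 & Hsmall).
  exists (Rmax X (X / x0)); intros t Ht; apply Rmax_le_elim in Ht; destruct Ht as [HXt Ht].
  assert (Hxt : X / t <= x0).
  { apply Rmult_le_compat_r with (r := x0) in Ht; [|lra].
    apply Rmult_le_reg_r with t; [lra|].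
    replace (X / t * t) with X by (field; lra).
    replace (X / x0 * x0) with X in Ht by (field; lra); lra. }
  specialize (Hsmall (X / t) ltac:(apply Rdiv_lt_0_compat; lra) Hxt).
  destruct (potter X t (Rle_refl X) HXt) as [_ Hpot].
  replace (mu - d) with (p + - (1)) in Hpot by ring.
  rewrite Rpower_plus, Rpower_Ropp, Rpower_1 in Hpot
    by (apply Rdiv_lt_0_compat; lra).
  apply Rle_trans with (1 := HYM).
  assert (HrX := r_pos X); assert (Hrt := r_pos t); assert (Hd := exp_pos d).
  assert (Hchain : r X * X <= exp d * (t * r t) * (X * r X / (exp d * Y))).
  { apply Rle_trans with (exp d * (t * r t) * Rpower (X / t) p).
    - apply Rmult_le_compat_r with (r := X) in Hpot; [|lra].
      replace (exp d * (r t * (Rpower (X / t) p * / (X / t))) * X)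
        with (exp d * (t * r t) * Rpower (X / t) p) in Hpot by (field; lra).
      exact Hpot.
    - apply Rmult_le_compat_l; [|exact Hsmall].
      apply Rlt_le, Rmult_lt_0_compat; [|apply Rmult_lt_0_compat]; lra. }
  replace (exp d * (t * r t) * (X * r X / (exp d * Y)))
    with (r X * X * (t * r t / Y)) in Hchain by (field; lra).
  assert (HrXX : 0 < r X * X) by (apply Rmult_lt_0_compat; lra).
  rewrite <- (Rmult_1_r (r X * X)) in Hchain at 1.
  apply Rmult_le_reg_l in Hchain; [|exact HrXX].
  apply Rmult_le_compat_r with (r := Y) in Hchain; [|lra].
  replace (t * r t / Y * Y) with (t * r t) in Hchain by (field; lra); lra.
Qed.

Lemma autocorrelation_finite (t : R) :
  0 <= t -> exists l, improper_int_0_inf (F t) l.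
Proof.
  intros Ht.
  set (C := X * (r X) ^ 2 * (exp d ^ 2 * Rpower 1 (q + 1) / - (q + 1))).
  assert (Hge : forall s, 0 <= F t s).
  { intros s; apply Rlt_le, Rmult_lt_0_compat; apply r_pos. }
  (* [X * 1] matches the tail bound at [u = X], [K = 1]. *)
  apply (improper_int_0_inf_bounded _ (RInt (F t) 0 (X * 1) + C));
    [apply continuous_autocorrelation_integrand, r_cont | exact Hge |].
  intros b.
  apply Rle_trans with (RInt (F t) 0 (Rmax (X * 1) b)).
  - apply RInt_upper_incr; [apply continuous_autocorrelation_integrand, r_cont | exact Hge |].
    apply Rmax_r.
  - rewrite (RInt_split _ 0 (X * 1)) by apply ex_RInt_autocorrelation.
    apply Rplus_le_compat_l, autocorrelation_tail_le; try lra; apply Rmax_l.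
Qed.

End PotterEstimates.

(** * The middle range and the limit *)

Lemma RV_autocorrelation_middle (r : R -> R) (mu eta K e : R) :
  (forall x, continuous r x) -> (forall x, 0 < r x) -> RV_inf mu r ->
  0 < eta -> eta <= K -> 0 < e ->
  exists T, 0 < T /\ forall t, T <= t ->
    let B := RInt (beta_integrand (1 + mu) (-1 - 2 * mu)) eta K in
    let I := RInt (fun s => r s * r (s + t)) (t * eta) (t * K) in
    exp (- e) ^ 2 * (r t) ^ 2 * (t * B) <= I <= exp e ^ 2 * (r t) ^ 2 * (t * B).
Proof.
  intros Hc Hpos HRV Heta HK He.
  (* The ratios s / t and (s + t) / t lie in [[eta, K]] and [[1 + eta, 1 + K]]; [K0] covers both and
     their inverses. Each factor costs one exp e, hence the squares. *)
  set (K0 := Rmax (/ eta) (K + 1)).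
  destruct (RV_uniform r mu K0 e Hc (fun x _ => Hpos x) HRV He) as (T & HT & Hunif).
  assert (HTe : 0 < T / eta) by (apply Rdiv_lt_0_compat; assumption).
  exists (Rmax T (T / eta)); split; [pose proof (Rmax_l T (T / eta)); lra|].
  intros t Ht; apply Rmax_le_elim in Ht; destruct Ht as [HTt HTeta].
  assert (Ht0 : 0 < t) by lra.
  assert (HTte : T <= t * eta).
  { apply Rmult_le_compat_r with (r := eta) in HTeta; [|lra].
    replace (T / eta * eta) with T in HTeta by (field; lra); exact HTeta. }
  assert (HKe : 1 <= K0 * eta).
  { rewrite <- (Rinv_l eta) by lra; apply Rmult_le_compat_r; [lra | apply Rmax_l]. }
  assert (HKK : K + 1 <= K0) by apply Rmax_r.
  cbv zeta.
  destruct (RInt_rescale (beta_integrand (1 + mu) (-1 - 2 * mu)) t eta K) as [Hex Heq];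
    try assumption; [intros; apply continuous_beta_integrand; assumption|].
  assert (HexF : ex_RInt (fun s => r s * r (s + t)) (t * eta) (t * K))
    by apply ex_RInt_autocorrelation, Hc.
  assert (Hle : t * eta <= t * K) by (apply Rmult_le_compat_l; lra).
  rewrite <- Heq, <- !RInt_scal_l by exact Hex.
  assert (Hpt : forall s, t * eta < s < t * K ->
    exp (- e) ^ 2 * r t ^ 2 * beta_integrand (1 + mu) (-1 - 2 * mu) (s / t) <=
    r s * r (s + t) <=
    exp e ^ 2 * r t ^ 2 * beta_integrand (1 + mu) (-1 - 2 * mu) (s / t)).
  { intros s Hs.
    assert (HtK0 : t <= K0 * s).
    { apply Rle_trans with (K0 * (t * eta)); [nra|].
      apply Rmult_le_compat_l; [nra | lra]. }
    destruct (Hunif s t ltac:(lra) HTt ltac:(nra) HtK0) as [H1 H2].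
    destruct (Hunif (s + t) t ltac:(lra) HTt ltac:(nra) ltac:(nra)) as [H3 H4].
    unfold beta_integrand.
    replace (1 + mu - 1) with mu by ring.
    replace (- (1 + mu + (-1 - 2 * mu))) with mu by ring.
    replace (1 + s / t) with ((s + t) / t) by (field; lra).
    split; [|apply Rmult_le_sq_compat; try assumption; apply Rlt_le, Hpos].
    replace (exp (- e) ^ 2 * r t ^ 2 * (Rpower (s / t) mu * Rpower ((s + t) / t) mu))
      with (exp (- e) * (r t * Rpower (s / t) mu) *
            (exp (- e) * (r t * Rpower ((s + t) / t) mu))) by ring.
    assert (Hnn : forall z, 0 <= exp (- e) * (r t * Rpower z mu)).
    { intros z; apply Rlt_le, Rmult_lt_0_compat; [apply exp_pos|].
      apply Rmult_lt_0_compat; [apply Hpos | apply Rpower_pos]. }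
    apply Rmult_le_compat; auto. }
  split; (apply RInt_le; [exact Hle | try exact HexF; apply ex_RInt_scal_l, Hex .. |];
          intros s Hs; apply Hpt, Hs).
Qed.

Lemma autocorrelation_asymptotics (r c : R -> R) (mu : R) :
  (forall x, continuous r x) -> (forall x, 0 < r x) -> -1 < mu < -1 / 2 -> RV_inf mu r ->
  (forall t, 0 <= t -> improper_int_0_inf (fun s => r s * r (s + t)) (c t)) ->
  lim_inf_to (fun t => c t / (t * (r t) ^ 2))
    (Gamma (-1 - 2 * mu) * Gamma (1 + mu) / Gamma (- mu)).
Proof.
  intros Hc Hpos Hmu HRV Hcint eps Heps.
  set (F := fun t s => r s * r (s + t)).
  (* Then [beta_integrand a b s] is s^mu (1 + s)^mu, and a + b = - mu gives the denominator. *)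
  set (a := 1 + mu); set (b := -1 - 2 * mu).
  pose proof (improper_int_open_beta a b ltac:(unfold a; lra) ltac:(unfold b; lra)) as Hbeta.
  replace (a + b) with (- mu) in Hbeta by (unfold a, b; ring).
  rewrite (Rmult_comm (Gamma b)).
  set (beta := Gamma a * Gamma b / Gamma (- mu)) in *.
  assert (Hbeta0 : 0 < beta).
  { apply Rdiv_lt_0_compat; [apply Rmult_lt_0_compat|]; apply Gamma_pos; unfold a, b; lra. }
  (* Half the distance from [mu] to each endpoint, so that p >= (mu + 1) / 2 > 0 and q + 1 <= mu +
     1/2 < 0. *)
  set (d := Rmin ((mu + 1) / 2) ((-1 / 2 - mu) / 2)).
  assert (Hd : 0 < d) by (apply Rmin_glb_lt; lra).
  assert (Hd1 : d <= (mu + 1) / 2) by apply Rmin_l.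
  assert (Hd2 : d <= (-1 / 2 - mu) / 2) by apply Rmin_r.
  destruct (RV_potter r mu d Hc (fun x _ => Hpos x) HRV Hd) as (X & HX & Hpot).
  set (A := exp d ^ 2); set (p := mu - d + 1); set (q := 2 * (mu + d)).
  assert (HA : 0 < A) by (apply pow_lt, exp_pos).
  assert (Hp : 0 < p) by (unfold p; lra).
  assert (Hq : 0 < - (q + 1)) by (unfold q; lra).
  (* The upper estimate loses 4 e (start, head, middle, tail) and the lower one 2 e; the fifth share
     makes the inequality strict. *)
  set (e := eps / 5); assert (He : 0 < e) by (unfold e; lra).
  destruct (Rpower_small p (e * p / A) Hp) as (x1 & Hx1 & Hhead).
  { apply Rdiv_lt_0_compat; [apply Rmult_lt_0_compat|]; assumption. }
  destruct (Rpower_small (- (q + 1)) (e * - (q + 1) / A) Hq) as (x2 & Hx2 & Htail).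
  { apply Rdiv_lt_0_compat; [apply Rmult_lt_0_compat|]; assumption. }
  destruct (improper_int_open_approx (beta_integrand a b) beta e
    (continuous_beta_integrand a b) Hbeta He) as (eta0 & K0 & Heta0 & HK0 & Happ).
  set (eta := Rmin (Rmin 1 eta0) x1).
  assert (Heta : 0 < eta) by (repeat apply Rmin_glb_lt; lra).
  assert (Heta' : eta <= 1 /\ eta <= eta0 /\ eta <= x1).
  { pose proof (Rmin_l (Rmin 1 eta0) x1); pose proof (Rmin_r (Rmin 1 eta0) x1).
    pose proof (Rmin_l 1 eta0); pose proof (Rmin_r 1 eta0); unfold eta; lra. }
  set (K := Rmax (Rmax 1 K0) (/ x2)).
  assert (HK : 1 <= K /\ K0 <= K /\ / x2 <= K).
  { pose proof (Rmax_l (Rmax 1 K0) (/ x2)); pose proof (Rmax_r (Rmax 1 K0) (/ x2)).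
    pose proof (Rmax_l 1 K0); pose proof (Rmax_r 1 K0); unfold K; lra. }
  assert (HheadE : A * Rpower eta p / p <= e).
  { specialize (Hhead eta Heta ltac:(lra)).
    apply Rmult_le_compat_l with (r := A / p) in Hhead;
      [|apply Rlt_le, Rdiv_lt_0_compat; assumption].
    replace (A / p * (e * p / A)) with e in Hhead by (field; lra).
    replace (A * Rpower eta p / p) with (A / p * Rpower eta p) by (field; lra); exact Hhead. }
  assert (HtailE : A * Rpower K (q + 1) / - (q + 1) <= e).
  { specialize (Htail (/ K) ltac:(apply Rinv_0_lt_compat; lra)).
    assert (HKx : / K <= x2).
    { rewrite <- (Rinv_inv x2); apply Rinv_le_contravar; [apply Rinv_0_lt_compat|]; lra. }
    specialize (Htail HKx).
    assert (Hinv : Rpower (/ K) (- (q + 1)) = Rpower K (q + 1)).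
    { unfold Rpower; rewrite ln_Rinv by lra; f_equal; ring. }
    rewrite Hinv in Htail.
    apply Rmult_le_compat_l with (r := A / - (q + 1)) in Htail;
      [|apply Rlt_le, Rdiv_lt_0_compat; assumption].
    replace (A / - (q + 1) * (e * - (q + 1) / A)) with e in Htail by (field; lra).
    replace (A * Rpower K (q + 1) / - (q + 1)) with (A / - (q + 1) * Rpower K (q + 1))
      by (field; lra); exact Htail. }
  set (B := RInt (beta_integrand a b) eta K).
  assert (HB : beta - e < B <= beta).
  { split.
    - specialize (Happ eta K Heta ltac:(lra) ltac:(lra)); apply Rabs_def2 in Happ.
      fold B in Happ; lra.
    - apply improper_int_open_ge; auto using continuous_beta_integrand; try lra.
      intros; apply Rlt_le, beta_integrand_pos. }
  (* Chosen so that (exp e')^2 = 1 + e / beta: as [B <= beta], the relative error of the middle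
     range costs at most [e]. *)
  set (e' := ln (1 + e / beta) / 2).
  assert (Heb : 0 < e / beta) by (apply Rdiv_lt_0_compat; assumption).
  assert (Hebb : e / beta * beta = e) by (field; lra).
  assert (He' : 0 < e').
  { unfold e'; pose proof (ln_increasing 1 (1 + e / beta) ltac:(lra) ltac:(lra)) as H.
    rewrite ln_1 in H; lra. }
  assert (Hexp : exp e' ^ 2 = 1 + e / beta).
  { rewrite <- (exp_ln (1 + e / beta)) by lra; simpl; rewrite Rmult_1_r, <- exp_plus.
    f_equal; unfold e'; field. }
  assert (Hexp' : 1 - e / beta <= exp (- e') ^ 2).
  { rewrite exp_Ropp, pow_inv, Hexp.
    apply Rmult_le_reg_r with (1 + e / beta); [lra|].
    rewrite Rinv_l by lra; nra. }
  assert (HeB : e / beta * B <= e).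
  { rewrite <- Hebb at 2; apply Rmult_le_compat_l; lra. }
  destruct (RV_autocorrelation_middle r mu eta K e' Hc Hpos HRV Heta ltac:(lra) He')
    as (T1 & HT1 & Hmid).
  set (M := RInt r 0 X).
  (* Once [t * r t] exceeds this threshold, the start exp d * r t * M is at most e * (t * r t ^
     2). *)
  destruct (id_mul_r_unbounded r mu d X Hpos HX Hpot Hp (exp d * M / e)) as [T2 HT2].
  assert (HXe : 0 < X / eta) by (apply Rdiv_lt_0_compat; assumption).
  exists (Rmax (Rmax T1 T2) (X / eta)).
  split; [pose proof (Rmax_r (Rmax T1 T2) (X / eta)); lra|].
  intros t Ht; apply Rlt_le, Rmax_le_elim in Ht; destruct Ht as [Ht HtX].
  apply Rmax_le_elim in Ht; destruct Ht as [Ht1 Ht2].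
  assert (Ht0 : 0 < t) by lra.
  assert (HXte : X <= t * eta).
  { apply Rmult_le_compat_r with (r := eta) in HtX; [|lra].
    replace (X / eta * eta) with X in HtX by (field; lra); exact HtX. }
  assert (HXt : X <= t) by nra.
  specialize (Hmid t Ht1); cbv zeta in Hmid; fold a b in Hmid; fold B in Hmid.
  assert (Hrt := Hpos t).
  set (D := t * r t ^ 2).
  assert (HD : 0 < D) by (apply Rmult_lt_0_compat; [exact Ht0 | apply pow_lt, Hrt]).
  assert (HFc : forall x, continuous (F t) x)
    by (apply continuous_autocorrelation_integrand, Hc).
  assert (HFex : forall u v, ex_RInt (F t) u v) by (intros; apply ex_RInt_cont, HFc).
  assert (HF0 : forall s, 0 <= F t s)
    by (intros; apply Rlt_le, Rmult_lt_0_compat; apply Hpos).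
  assert (Hct : improper_int_0_inf (F t) (c t)) by (apply Hcint; lra).
  assert (Hle : t * eta <= t * K) by (apply Rmult_le_compat_l; lra).
  assert (Hstart : RInt (F t) 0 X <= D * e).
  { apply Rle_trans with (1 := autocorrelation_start_le r mu d X Hc Hpos HX Hpot ltac:(lra) t HXt).
    fold M; specialize (HT2 t Ht2).
    apply Rmult_le_compat_l with (r := r t * e) in HT2; [|nra].
    replace (r t * e * (exp d * M / e)) with (exp d * r t * M) in HT2 by (field; lra).
    unfold D; replace (t * r t ^ 2 * e) with (r t * e * (t * r t)) by ring; exact HT2. }
  assert (Hhd : RInt (F t) X (t * eta) <= D * e).
  { apply Rle_trans with (D * (A * Rpower eta p / p)).
    - apply (autocorrelation_head_le r mu d X); auto; lra.
    - apply Rmult_le_compat_l; lra. }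
  assert (Hupper : c t <= D * (beta + 4 * e)).
  { apply (improper_int_0_inf_le (F t) _ _ (t * K) HFc Hct); intros z Hz.
    assert (Htl : RInt (F t) (t * K) z <= D * e).
    { apply Rle_trans with (D * (A * Rpower K (q + 1) / - (q + 1))).
      - apply (autocorrelation_tail_le r mu d X); auto; unfold q in Hq; lra.
      - apply Rmult_le_compat_l; lra. }
    assert (Hmd : RInt (F t) (t * eta) (t * K) <= D * (beta + e)).
    { apply Rle_trans with (1 := proj2 Hmid); rewrite Hexp.
      replace ((1 + e / beta) * r t ^ 2 * (t * B)) with (D * (B + e / beta * B))
        by (unfold D; ring).
      apply Rmult_le_compat_l; lra. }
    rewrite (RInt_split _ 0 (t * K)), (RInt_split _ 0 (t * eta) (t * K)),
      (RInt_split _ 0 X (t * eta)) by apply HFex.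
    lra. }
  (* By positivity only the middle range is kept: one [e] is lost from truncating the beta integral,
     one from uniform convergence. *)
  assert (Hlower : D * (beta - 2 * e) <= c t).
  { apply Rle_trans with (RInt (F t) 0 (t * K)).
    - rewrite (RInt_split _ 0 (t * eta)) by apply HFex.
      assert (0 <= RInt (F t) 0 (t * eta)) by (apply RInt_ge_0; auto; lra).
      apply Rle_trans with (RInt (F t) (t * eta) (t * K)); [|lra].
      apply Rle_trans with (2 := proj1 Hmid).
      replace (exp (- e') ^ 2 * r t ^ 2 * (t * B)) with (D * (exp (- e') ^ 2 * B))
        by (unfold D; ring).
      apply Rmult_le_compat_l; [lra|].
      apply Rle_trans with ((1 - e / beta) * B); [lra|].
      apply Rmult_le_compat_r; [|exact Hexp'].
      apply RInt_ge_0; [lra | apply ex_RInt_beta; lra |].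
      intros; apply Rlt_le, beta_integrand_pos.
    - apply improper_int_0_inf_ge; assumption. }
  assert (Hcancel : c t / D * D = c t) by (field; lra).
  apply Rabs_def1; apply Rmult_lt_reg_r with D; try exact HD;
    rewrite Rmult_minus_distr_r, Hcancel; unfold e in *; nra.
Qed.

Lemma autocorrelation_finite_RV (r : R -> R) (mu : R) :
  (forall x, continuous r x) -> (forall x, 0 < r x) -> -1 < mu < -1 / 2 -> RV_inf mu r ->
  exists c : R -> R,
    forall t, 0 <= t -> improper_int_0_inf (fun s => r s * r (s + t)) (c t).
Proof.
  intros Hc Hpos Hmu HRV.
  (* With this [d] the tail exponent 2 (mu + d) equals mu - 1/2, which is below -1. *)
  destruct (RV_potter r mu ((-1 / 2 - mu) / 2) Hc (fun x _ => Hpos x) HRV) as (X & HX & Hpot);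
    [lra|].
  exists (fun t => epsilon (inhabits 0) (improper_int_0_inf (fun s => r s * r (s + t)))).
  intros t Ht; apply (epsilon_spec (inhabits 0) (improper_int_0_inf _)).
  apply (autocorrelation_finite r mu ((-1 / 2 - mu) / 2) X); auto; lra.
Qed.

(** * From the half-line to the whole line *)

Lemma improper_int_0_inf_ext (f g : R -> R) (l : R) :
  (forall x, 0 <= x -> f x = g x) -> improper_int_0_inf f l -> improper_int_0_inf g l.
Proof.
  intros Hfg [Hex Hl]; split.
  - intros b Hb; destruct (Hex b Hb) as [pr]; constructor.
    apply ex_RInt_Reals_0, (ex_RInt_ext f); [|apply ex_RInt_Reals_1, pr].
    rewrite Rmin_left by exact Hb; intros x Hx; apply Hfg; lra.
  - intros eps Heps; destruct (Hl eps Heps) as (B & HB & H).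
    exists B; split; [exact HB|]; intros b pr Hb.
    destruct (Hex b ltac:(lra)) as [pr'].
    rewrite <- RInt_Reals, <- (RInt_ext_le f), (RInt_Reals _ _ _ pr').
    + apply H, Hb.
    + lra.
    + intros x Hx; apply Hfg; lra.
Qed.

Lemma continuous_even_extension (r : R -> R) (x : R) :
  continuous_on_nonneg r -> continuous (fun s => r (Rabs s)) x.
Proof.
  intros Hr; apply continuity_pt_filterlim; intros eps Heps.
  destruct (Hr (Rabs x) (Rabs_pos x) eps Heps) as (d & Hd & H).
  exists d; split; [exact Hd|]; intros y [_ Hy]; apply H; split; [apply Rabs_pos|].
  apply Rle_lt_trans with (2 := Hy); apply Rabs_triang_inv2.
Qed.

Theorem theorem7p1 (r : R -> R) (mu : R) :
  continuous_on_nonneg r ->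
  (forall t, 0 <= t -> 0 < r t) ->
  -1 < mu < -1/2 ->
  RV_inf mu r ->
  exists c : R -> R,
    (forall t, 0 <= t -> improper_int_0_inf (fun s => r s * r (s + t)) (c t)) /\
    lim_inf_to (fun t => c t / (t * (r t)^2))
      (Gamma (-1 - 2 * mu) * Gamma (1 + mu) / Gamma (- mu)) /\
    Gamma (-1 - 2 * mu) * Gamma (1 + mu) / Gamma (- mu) > 0.
Proof.
  intros Hr Hpos Hmu (L & HL & Hs & HrL).
  (* The even extension is continuous and positive on the whole line, as the preceding lemmas
     require, and agrees with [r] wherever the integrals and the limit look. *)
  set (rho := fun s => r (Rabs s)).
  assert (Hrho : forall s, 0 <= s -> rho s = r s).
  { intros s H; unfold rho; rewrite Rabs_pos_eq by exact H; reflexivity. }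
  assert (Hc : forall x, continuous rho x).
  { intros x; apply continuous_even_extension, Hr. }
  assert (Hrpos : forall x, 0 < rho x) by (intros; apply Hpos, Rabs_pos).
  assert (HRV : RV_inf mu rho).
  { exists L; split; [exact HL|]; split; [exact Hs|].
    intros t Ht; rewrite Hrho by lra; apply HrL, Ht. }
  destruct (autocorrelation_finite_RV rho mu Hc Hrpos Hmu HRV) as [c Hcint].
  exists c; split; [|split].
  - intros t Ht; apply (improper_int_0_inf_ext (fun s => rho s * rho (s + t))); [|auto].
    intros s H; rewrite !Hrho by lra; reflexivity.
  - intros eps Heps.
    destruct (autocorrelation_asymptotics rho c mu Hc Hrpos Hmu HRV Hcint eps Heps)
      as (T & HT & H).
    exists T; split; [exact HT|]; intros t Ht.
    rewrite <- (Hrho t) by lra; apply H, Ht.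
  - apply Rdiv_lt_0_compat; [apply Rmult_lt_0_compat|]; apply Gamma_pos; lra.
Qed.
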